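(* Let $K$ be the kernel of $U_{5}+I$ acting on the space $M(\mathit{odd})$ of odd mod 2 modular forms of level $\Gamma_{0}(5)$. Then $K\subset N2$, and the composition of $N2\rightarrow N2/N1$ with the projection map $N2/N1=N2a\oplus N2b\rightarrow N2a$ maps $K$ bijectively to $N2a$.
   Context: Let $r=\sum_{n>0}(x^{n^{2}}+x^{2n^{2}}+x^{5n^{2}}+x^{10n^{2}})\in \mathbb{Z}/2[[x]]$. The space $M$ of mod 2 modular forms of level $\Gamma_{0}(5)$ is the subspace $\mathbb{Z}/2[r]$ of $\mathbb{Z}/2[[x]]$, and $M(\mathit{odd})$ is the subspace of odd power series in $M$; it is the span of the $(r^{2}+r)r^{2n}$, $n\ge 0$. $U_{5}:\mathbb{Z}/2[[x]]\to\mathbb{Z}/2[[x]]$ takes $\sum c_{n}x^{n}$ to $\sum c_{5n}x^{n}$; it stabilizes $M(\mathit{odd})$. $I$ is the identity map. Let $F=r(r+1)^{5}=\sum_{n \text{ odd},\,n>0}x^{n^{2}}$ and $G=r^{5}(r+1)=\sum_{n\text{ odd},\,n>0}x^{5n^{2}}$. $N2$ and $N1$ are the (free) $\mathbb{Z}/2[G^{2}]$-submodules of $M(\mathit{odd})$ with bases $\{G,F,F^{2}G,F^{3},F^{4}G\}$ and $\{G\}$ respectively. $J_{1}=F$, $J_{7}=F^{2}G$, $J_{9}=F^{4}G$, $J_{3}=F^{8}/G$, and $J_{k}$ is defined for all $k>0$ prime to $10$ by $J_{k+10}=G^{2}J_{k}$; the images of the $J_{k}$ (denoted by the same symbols) form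 a $\mathbb{Z}/2$-basis of $N2/N1$. $N2a$ is the subspace of $N2/N1$ spanned by the $J_{k}$ with $k\equiv 1,3,7,9\bmod 20$, and $N2b$ is the subspace spanned by the $J_{k}$ with $k\equiv 11,13,17,19\bmod 20$; thus $N2/N1=N2a\oplus N2b$. *)

(* Defs.v *)
From HB Require Import structures.
From mathcomp Require Import all_boot all_order all_algebra.
From mathcomp Require Import generic_quotient ring_quotient.
From mathcomp Require Import boolp classical_sets functions.

Set Implicit Arguments.
Unset Strict Implicit.
Unset Printing Implicit Defensive.

Import GRing.Theory.
Local Open Scope ring_scope.
Local Open Scope classical_set_scope.

(* R[[x]]; a power series coerces to its sequence of coefficients. *)
Record fps (R : Type) := FPS { fps_coef :> nat -> R }.

HB.instance Definition _ (R : Type) := gen_eqMixin (fps R).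
HB.instance Definition _ (R : Type) := gen_choiceMixin (fps R).

Lemma fpsP (R : Type) (f g : fps R) : f =1 g -> f = g.
Proof. by case: f g => [f] [g] fg; congr FPS; apply/funext. Qed.

Section FpsAlgebra.
Variable R : comNzRingType.
Implicit Types (f g h : fps R) (a b : R).

Definition fps_zero : fps R := FPS (fun=> 0).
Definition fps_opp f : fps R := FPS (fun n => - f n).
Definition fps_add f g : fps R := FPS (fun n => f n + g n).
Definition fps_one : fps R := FPS (fun n => (n == 0%N)%:R).
Definition fps_mul f g : fps R :=
  FPS (fun n => \sum_(i < n.+1) f i * g (n - i)%N).
Definition fps_scale a f : fps R := FPS (fun n => a * f n).

Fact fps_addA : associative fps_add.
Proof. by move=> f g h; apply: fpsP => n /=; rewrite addrA. Qed.
Fact fps_addC : commutative fps_add.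
Proof. by move=> f g; apply: fpsP => n /=; rewrite addrC. Qed.
Fact fps_add0 : left_id fps_zero fps_add.
Proof. by move=> f; apply: fpsP => n /=; rewrite add0r. Qed.
Fact fps_addN : left_inverse fps_zero fps_opp fps_add.
Proof. by move=> f; apply: fpsP => n /=; rewrite addNr. Qed.

HB.instance Definition _ :=
  GRing.isZmodule.Build (fps R) fps_addA fps_addC fps_add0 fps_addN.

Definition fps_trunc m f : {poly R} := \poly_(i < m) f i.

Lemma fps_mul_trunc m f g n : (n < m)%N ->
  fps_mul f g n = (fps_trunc m f * fps_trunc m g)`_n.
Proof.
move=> lt_nm; rewrite coefM /=; apply: eq_bigr => i _.
rewrite !coef_poly (leq_ltn_trans (leq_subr _ _) lt_nm).
by rewrite (leq_ltn_trans _ lt_nm) // -ltnS.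
Qed.

Fact fps_mulC : commutative fps_mul.
Proof.
by move=> f g; apply: fpsP => n; rewrite !(@fps_mul_trunc n.+1) // mulrC.
Qed.

Fact fps_mulA : associative fps_mul.
Proof.
move=> f g h; apply: fpsP => n; rewrite !(@fps_mul_trunc n.+1) //.
have truncM u v k : (k <= n)%N -> (fps_trunc n.+1 (fps_mul u v))`_k
    = (fps_trunc n.+1 u * fps_trunc n.+1 v)`_k.
  by move=> le_kn; rewrite coef_poly ltnS le_kn (@fps_mul_trunc n.+1).
have -> : (fps_trunc n.+1 f * fps_trunc n.+1 (fps_mul g h))`_n =
    (fps_trunc n.+1 f * (fps_trunc n.+1 g * fps_trunc n.+1 h))`_n.
  rewrite !coefM; apply: eq_bigr => i _.
  by rewrite truncM ?leq_subr.
rewrite mulrA [in LHS]coefM [in RHS]coefM; apply: eq_bigr => i _.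
by rewrite truncM // -ltnS.
Qed.

Fact fps_mul1 : left_id fps_one fps_mul.
Proof.
move=> f; apply: fpsP => n /=; rewrite big_ord_recl /= mul1r subn0.
by rewrite big1 ?addr0 // => i _; rewrite mul0r.
Qed.

Fact fps_mulDl : left_distributive fps_mul fps_add.
Proof.
move=> f g h; apply: fpsP => n /=; rewrite -big_split /=.
by apply: eq_bigr => i _; rewrite mulrDl.
Qed.

Fact fps_one_neq0 : fps_one != fps_zero.
Proof. by apply/eqP => /(congr1 (fun f => f 0%N)) /eqP; rewrite /= oner_eq0. Qed.

HB.instance Definition _ := GRing.Zmodule_isComNzRing.Build (fps R)
  fps_mulA fps_mulC fps_mul1 fps_mulDl fps_one_neq0.

Fact fps_scaleA a b f : fps_scale a (fps_scale b f) = fps_scale (a * b) f.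
Proof. by apply: fpsP => n /=; rewrite mulrA. Qed.
Fact fps_scale1 : left_id 1 fps_scale.
Proof. by move=> f; apply: fpsP => n /=; rewrite mul1r. Qed.
Fact fps_scaleDr : right_distributive fps_scale +%R.
Proof. by move=> a f g; apply: fpsP => n /=; rewrite mulrDr. Qed.
Fact fps_scaleDl f : {morph fps_scale^~ f : a b / a + b}.
Proof. by move=> a b; apply: fpsP => n /=; rewrite mulrDl. Qed.

HB.instance Definition _ := GRing.Zmodule_isLmodule.Build R (fps R)
  fps_scaleA fps_scale1 fps_scaleDr fps_scaleDl.

Fact fps_scaleAl a f g : a *: (f * g) = (a *: f) * g.
Proof.
apply: fpsP => n /=; rewrite big_distrr /=.
by apply: eq_bigr => i _; rewrite mulrA.
Qed.

HB.instance Definition _ :=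
  GRing.Lmodule_isLalgebra.Build R (fps R) fps_scaleAl.
HB.instance Definition _ := GRing.Lalgebra_isComAlgebra.Build R (fps R).

End FpsAlgebra.

(* The quotient f / g when g divides f in the ring A (unique if A is a domain);
   the default value is 0. *)
Definition exact_quo (A : pzRingType) (f g : A) : A :=
  xget 0 [set h | h * g = f].

Definition lin_span (K : pzRingType) (V : lmodType K) (S : set V) : set V :=
  [set v | exists (n : nat) (c : 'I_n -> K) (w : 'I_n -> V),
     (forall i, S (w i)) /\ v = \sum_(i < n) c i *: w i].

(* The projection A + B -> A along B when the sum is direct; the default value
   outside A + B is 0. *)
Definition proj_along (V : zmodType) (A B : set V) (v : V) : V :=
  xget 0 [set u | A u /\ B (v - u)].

Notation Z2x := (fps 'F_2).

(* In the coefficient of x^m only indices n with n <= m can contribute. *)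
Definition r : Z2x := FPS (fun m => \sum_(1 <= n < m.+1)
  ((m == n ^ 2)%N%:R + (m == 2 * n ^ 2)%N%:R
   + (m == 5 * n ^ 2)%N%:R + (m == 10 * n ^ 2)%N%:R)).

Definition F : Z2x := r * (r + 1) ^+ 5.
Definition G : Z2x := r ^+ 5 * (r + 1).

Definition M : set Z2x := range (horner_alg r).

Definition Modd : set Z2x :=
  M `&` [set f : Z2x | forall n, ~~ odd n -> f n = 0].

Definition U5 (f : Z2x) : Z2x := FPS (fun n => f (5 * n)%N).

(* The Z/2[G^2]-submodule of Z/2[[x]] generated by the entries of B. *)
Definition G2span (B : seq Z2x) : {pred Z2x} := fun f =>
  `[< exists c : nat -> {poly 'F_2},
        f = \sum_(i < size B) horner_alg (G ^+ 2) (c i) * B`_i >].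

Fact G2span_submod_closed B : submod_closed (G2span B).
Proof.
split=> [|a f g /asboolP[c ->] /asboolP[d ->]]; apply/asboolP.
  by exists (fun=> 0); rewrite big1 // => i _; rewrite rmorph0 mul0r.
exists (fun i => a *: c i + d i); rewrite scaler_sumr -big_split /=.
by apply: eq_bigr => i _; rewrite linearP /= mulr_algl mulrDl scalerAl.
Qed.

HB.instance Definition _ B :=
  GRing.isSubmodClosed.Build 'F_2 Z2x (G2span B) (G2span_submod_closed B).

Definition N2 : {pred Z2x} :=
  G2span [:: G; F; F ^+ 2 * G; F ^+ 3; F ^+ 4 * G].
Definition N1 : {pred Z2x} := G2span [:: G].

HB.instance Definition _ := GRing.SubmodClosed.on N2.
HB.instance Definition _ := GRing.SubmodClosed.on N1.

(* Z/2[[x]] / N1; the quotient N2 / N1 is the image of N2 in it. *)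
Definition modN1 := Quotient.quot N1.

HB.instance Definition _ := GRing.Zmodule.on modN1.
HB.instance Definition _ := EqQuotient.on modN1.

Definition piN1 (f : Z2x) : modN1 := \pi_modN1%qT f.

Fact piN1_is_zmod_morphism : zmod_morphism piN1.
Proof. exact: (raddfB \pi_modN1%qT). Qed.

HB.instance Definition _ :=
  GRing.isZmodMorphism.Build Z2x modN1 piN1 piN1_is_zmod_morphism.

Lemma eq_piN1 f g : (piN1 f == piN1 g) = (f - g \in N1).
Proof. by rewrite Quotient.idealrBE. Qed.

Lemma repr_piN1 (v : modN1) : piN1 (repr v) = v.
Proof. exact: reprK. Qed.

Definition modN1_scale (a : 'F_2) (v : modN1) : modN1 := piN1 (a *: repr v).

Lemma piN1Z a f : modN1_scale a (piN1 f) = piN1 (a *: f).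
Proof.
apply/eqP; rewrite eq_piN1 -scalerBr rpredZ // -eq_piN1.
by rewrite repr_piN1.
Qed.

Fact modN1_scaleA a b v :
  modN1_scale a (modN1_scale b v) = modN1_scale (a * b) v.
Proof. by rewrite -(repr_piN1 v) !piN1Z scalerA. Qed.
Fact modN1_scale1 : left_id 1 modN1_scale.
Proof. by move=> v; rewrite -(repr_piN1 v) piN1Z scale1r. Qed.
Fact modN1_scaleDr : right_distributive modN1_scale +%R.
Proof.
move=> a u v; rewrite -(repr_piN1 u) -(repr_piN1 v) -raddfD !piN1Z -raddfD.
by rewrite scalerDr.
Qed.
Fact modN1_scaleDl v : {morph modN1_scale^~ v : a b / a + b}.
Proof. by move=> a b; rewrite -(repr_piN1 v) !piN1Z -raddfD scalerDl. Qed.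

HB.instance Definition _ := GRing.Zmodule_isLmodule.Build 'F_2 modN1
  modN1_scaleA modN1_scale1 modN1_scaleDr modN1_scaleDl.

(* Meant for k prime to 10; the value 0 at other k is junk. *)
Definition J (k : nat) : Z2x :=
  G ^+ (2 * (k %/ 10)) *
  match (k %% 10)%N with
  | 1 => F
  | 3 => exact_quo (F ^+ 8) G
  | 7 => F ^+ 2 * G
  | 9 => F ^+ 4 * G
  | _ => 0
  end.

Fact J3_mulG : J 3 * G = F ^+ 8.
Proof.
rewrite /J mul1r /exact_quo; case: xgetP => [h _ // | ].
move=> /(_ (r ^+ 3 * (r + 1) ^+ 39)) [] /=.
by rewrite /F /G mulrACA -exprD -exprSr exprMn -exprM.
Qed.

Definition N2a : set modN1 :=
  lin_span [set piN1 (J k) | k in [set k | (k %% 20)%N \in [:: 1; 3; 7; 9]%N]].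
Definition N2b : set modN1 :=
  lin_span
    [set piN1 (J k) | k in [set k | (k %% 20)%N \in [:: 11; 13; 17; 19]%N]].

Definition K : set Z2x := [set f | Modd f /\ U5 f + f = 0].

(* Main.v *)
From HB Require Import structures.
Require Import Defs.
From mathcomp Require Import all_boot all_order all_algebra.
From mathcomp Require Import boolp classical_sets functions.
From mathcomp Require Import zify ring.

Set Implicit Arguments.
Unset Strict Implicit.
Unset Printing Implicit Defensive.

Import Order.TTheory GRing.Theory Num.Theory.
Local Open Scope ring_scope.

(** Put t = r^2 + r = F + G, and let w be the involution r -> r + 1 of Z/2[r], which
fixes t and exchanges F and G.

The operator U5 is w up to a trace. Let P and Q be the sums of x^(n^2) over the n > 0
that are 1 or 4, respectively 2 or 3, modulo 5. Counting lattice points of norm 5 N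
for m^2 + n^2 and m^2 + 4 n^2 (count_qform_mul5) gives, over Z and then modulo 2,
P Q = r(x^5) and P^5 + Q^5 = (r + r^2)(x^5), while r = P Q + P + Q + P^2 + Q^2 splits r
by exponents modulo 5. Hence G = F(x^5), so that U5 (G f) = F U5 f, and U5 is known on
1, r, ..., r^5, which span Z/2[r] over Z/2[G]. It follows that
U5 h(r) = h(r + 1) + defect h with a defect in Z/2[F] that satisfies
defect (G h) = F defect h, vanishes on 1, t, ..., t^4 and is F on t^5.

If U5 f = f, then f + w f lies in Z/2[F], and in Z/2[G] because it is fixed by w; the
orders of F and G at x = 0 force it to be constant, and then 0. Since every odd form is
t a^2 with a in Z/2[r], the kernel K consists of the odd polynomials in t without defect
(K_iff_T).

The equation t^6 = G t + G^2 rewrites the odd powers of t in the monomials G^b t^a with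
a < 6 and a + b odd. The monomials with a < 5 have the distinct orders 5 b + a at x = 0;
they lie in N2, and those of order 1, 3, 7, 9 modulo 20 span N2a modulo N1, while
the others span N1 and N2b. The main point is triangularity (t_pow_triangular): modulo
the monomials belonging to N1 and N2b, the odd power t^(2 m + 1) is the sum of the m-th
remaining monomial and of earlier ones. So modulo those monomials the odd polynomials in t
are all the combinations of the remaining monomials, each exactly once. As the defect only
sees the terms G^b t^5, the elements of K correspond to the combinations free of
t^5, and these are N2a. *)

(** * Substitution of x^k, residue classes of exponents, theta series *)

Section Dilation.
Variable R : comNzRingType.
Implicit Types (f g : fps R) (k : nat).

Lemma fps_coefD f g n : (f + g) n = f n + g n. Proof. by []. Qed.
Lemma fps_coefN f n : (- f) n = - f n. Proof. by []. Qed.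
Lemma fps_coefZ a f n : (a *: f) n = a * f n. Proof. by []. Qed.
Lemma fps_coef1 n : (1 : fps R) n = (n == 0%N)%:R. Proof. by []. Qed.
Lemma fps_coefM f g n : (f * g) n = \sum_(i < n.+1) f i * g (n - i)%N.
Proof. by []. Qed.
Lemma fps_coefMn f k n : (f *+ k) n = f n *+ k.
Proof. by elim: k => // k IH; rewrite !mulrS fps_coefD IH. Qed.

(** f(x^k) *)
Definition dilate k f : fps R :=
  FPS (fun n => if (k %| n)%N then f (n %/ k)%N else 0).
(** Hecke's operator U_k on coefficients. *)
Definition decimate k f : fps R := FPS (fun n => f (k * n)%N).

Fact dilate_is_zmod_morphism k : zmod_morphism (dilate k).
Proof. by move=> f g; apply: fpsP => n /=; case: ifP; rewrite ?subr0. Qed.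
Fact decimate_is_zmod_morphism k : zmod_morphism (decimate k).
Proof. by move=> f g; apply: fpsP => n. Qed.

HB.instance Definition _ k := GRing.isZmodMorphism.Build _ _ (dilate k) (dilate_is_zmod_morphism k).
HB.instance Definition _ k := GRing.isZmodMorphism.Build _ _ (decimate k) (decimate_is_zmod_morphism k).

(** Reindexing behind the projection formula below. *)
Lemma sum_dvdn k n (H : nat -> R) : (0 < k)%N ->
  \sum_(i < (k * n).+1 | (k %| i)%N) H i = \sum_(j < n.+1) H (k * j)%N.
Proof.
move=> k0.
have lt (j : 'I_n.+1) : (k * j < (k * n).+1)%N.
  by rewrite ltnS leq_mul2l -ltnS ltn_ord orbT.
have gt (i : 'I_(k * n).+1) : (i %/ k < n.+1)%N.
  by rewrite ltnS -{2}(mulKn n k0) leq_div2r // -ltnS ltn_ord.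
rewrite (reindex_onto (fun j => Ordinal (lt j)) (fun i => Ordinal (gt i))) /=.
  apply: eq_bigl => j; rewrite dvdn_mulr //=.
  by apply/eqP/val_inj; rewrite /= mulKn.
by move=> i ki; apply/val_inj; rewrite /= mulnC divnK.
Qed.

(** Projection formula U_k(f(x^k) g) = f U_k(g): only the exponents divisible by k
in g contribute. *)
Lemma decimate_dilateM k f g : (0 < k)%N -> decimate k (dilate k f * g) = f * decimate k g.
Proof.
move=> k0; apply: fpsP => n; rewrite [decimate _ _ n]/= !fps_coefM.
rewrite (bigID (fun i : 'I__ => (k %| i)%N)) /= [X in _ + X]big1 ?addr0; last first.
  by move=> i /negPf ->; rewrite mul0r.
under eq_bigr => i ki do rewrite ki.
rewrite (@sum_dvdn k n (fun i => f (i %/ k)%N * g (k * n - i)%N)) //.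
by apply: eq_bigr => j _; rewrite mulKn //= mulnBr.
Qed.

Lemma dilateK k : (0 < k)%N -> cancel (dilate k) (decimate k).
Proof. by move=> k0 f; apply: fpsP => n /=; rewrite dvdn_mulr // mulKn. Qed.

Lemma dilate_dilate k l f : (0 < k)%N -> (0 < l)%N -> dilate k (dilate l f) = dilate (k * l) f.
Proof.
move=> k0 l0; apply: fpsP => n /=; rewrite divnMA.
have [kn|kn] := boolP (k %| n)%N; last first.
  rewrite ifN //; apply: contra kn; apply: dvdn_trans.
  by rewrite dvdn_mulr.
by rewrite -{3}(divnK kn) (mulnC k) dvdn_pmul2r.
Qed.

(** Grading by exponents modulo k. It is multiplicative, so that products can be
sorted by residue class before U_k is applied. *)
Definition supported k c f := forall n, (n %% k)%N != (c %% k)%N -> f n = 0.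

Lemma supportedM k c d f g : supported k c f -> supported k d g -> supported k (c + d) (f * g).
Proof.
move=> cf dg n ncd; rewrite fps_coefM big1 // => i _.
have [ic|/cf ->] := eqVneq (i %% k)%N (c %% k)%N; last by rewrite mul0r.
have [id|/dg ->] := eqVneq ((n - i) %% k)%N (d %% k)%N; last by rewrite mulr0.
case/eqP: ncd; rewrite -modnDm -ic -id modnDm subnKC //.
by rewrite -ltnS ltn_ord.
Qed.

Lemma supportedD k c f g : supported k c f -> supported k c g -> supported k c (f + g).
Proof. by move=> cf cg n nc; rewrite fps_coefD cf ?cg ?addr0. Qed.

Lemma supported_dilate k f : (0 < k)%N -> supported k 0 (dilate k f).
Proof. by move=> k0 n; rewrite mod0n /= => /negPf kn; rewrite /dvdn kn. Qed.

Lemma supported_dilateM k l c f : (0 < l)%N -> supported k c f -> supported k (l * c) (dilate l f).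
Proof.
move=> l0 cf n nlc /=; case: ifP => // ln; apply: cf; apply: contra nlc => /eqP e.
by rewrite -{1}(divnK ln) mulnC -modnMmr e modnMmr.
Qed.

Lemma decimate_eq0 k c f : (c %% k != 0)%N -> supported k c f -> decimate k f = 0.
Proof.
by move=> c0 cf; apply: fpsP => n /=; rewrite cf // modnMr eq_sym.
Qed.

Lemma dilate_decimate k f : (0 < k)%N -> supported k 0 f -> dilate k (decimate k f) = f.
Proof.
move=> k0 cf; apply: fpsP => n /=; case: ifP => kn.
  by rewrite mulnC divnK.
by rewrite cf // mod0n -/(dvdn k n) kn.
Qed.

Lemma dilateM k f g : (0 < k)%N -> dilate k (f * g) = dilate k f * dilate k g.
Proof.
move=> k0; have s : supported k 0 (dilate k f * dilate k g).
  by apply: (@supportedM k 0 0); apply: supported_dilate.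
by rewrite -[RHS](dilate_decimate k0 s) decimate_dilateM // dilateK.
Qed.

Lemma dilate1 k : (0 < k)%N -> dilate k 1 = 1.
Proof.
move=> k0; apply: fpsP => n /=; case: ifP => [kn|/negbT kn].
  by rewrite -(divnK kn) mulnK // muln_eq0 (gtn_eqF k0) orbF.
by case: n kn => //; rewrite dvdn0.
Qed.

Lemma decimateD k f g : decimate k (f + g) = decimate k f + decimate k g. Proof. exact: raddfD. Qed.
Lemma decimateMn k f m : decimate k (f *+ m) = decimate k f *+ m. Proof. exact: raddfMn. Qed.
Lemma dilateD k f g : dilate k (f + g) = dilate k f + dilate k g. Proof. exact: raddfD. Qed.
Lemma dilateMn k f m : dilate k (f *+ m) = dilate k f *+ m. Proof. exact: raddfMn. Qed.
End Dilation.
Arguments supported {R} k c f.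

Section Theta.
Variable R : comNzRingType.
Implicit Types c : pred nat.

Definition theta c : fps R :=
  FPS (fun m => \sum_(1 <= n < m.+1 | c n) (m == n ^ 2)%N%:R).

Lemma thetaE c m B : (m <= B)%N ->
  theta c m = \sum_(1 <= n < B.+1 | c n) (m == n ^ 2)%N%:R.
Proof.
move=> mB; rewrite /= (@big_cat_nat _ _ _ m.+1 1 B.+1) //=.
rewrite [X in _ + X]big_nat_cond [X in _ + X]big1 ?addr0 //.
move=> i /andP[/andP[mi _] _]; rewrite (_ : (_ == _) = false) //.
by apply/negbTE/negP => /eqP e; move: mi; rewrite e; nia.
Qed.

Lemma theta_split c d : theta c = theta (predI c d) + theta (predD c d).
Proof.
apply: fpsP => m; rewrite fps_coefD /= (bigID d) /=; congr (_ + _).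
by apply: eq_bigl => i; rewrite /= andbC.
Qed.

(** The terms with p | n: (p m)^2 = p^2 m^2. *)
Lemma theta_dvd p : (0 < p)%N -> theta (dvdn p) = dilate (p ^ 2) (theta predT).
Proof.
move=> p0; apply: fpsP => m.
have p20 : (0 < p ^ 2)%N by rewrite expn_gt0 p0.
rewrite (@thetaE _ _ (p * m)); last by rewrite leq_pmull.
transitivity (\sum_(1 <= j < m.+1) (m == (p * j) ^ 2)%N%:R : R).
  rewrite !big_add1 !big_mkord /=.
  have := @sum_dvdn R p m (fun n => ((0 < n)%N && (m == n ^ 2)%N)%:R) p0.
  rewrite big_mkcond big_ord_recl /= dvdn0 add0r -big_mkcond /= => e.
  apply: etrans (etrans e _); first exact: eq_bigr.
  rewrite big_ord_recl /= muln0 add0r.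
  by apply: eq_bigr => i _; rewrite muln_gt0 p0 /=.
rewrite -[dilate _ _ _]/(if (p ^ 2 %| m)%N then theta predT (m %/ p ^ 2)%N else 0).
case: ifP => pm.
  rewrite (@thetaE _ _ m) ?leq_div //; apply: eq_bigr => j _.
  by rewrite expnMn -{1}(divnK pm) mulnC eqn_pmul2l.
rewrite big1 // => j _; rewrite (_ : (_ == _) = false) //.
by apply/negbTE/negP => /eqP e; rewrite e expnMn dvdn_mulr in pm.
Qed.

Lemma supported_theta k c d : {subset c <= [pred n | (n ^ 2 %% k == d %% k)%N]} ->
  supported k d (theta c).
Proof.
move=> cd m md /=; rewrite big1 // => n cn; case: eqP => // e.
by case/negP: md; rewrite e; apply: cd.
Qed.

End Theta.

(** * Lattice points and the Hecke relation at 5 *)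

Section Lattice.

Definition int_ball B : seq int :=
  0 :: [seq n%:Z | n <- index_iota 1 B.+1] ++ [seq - n%:Z | n <- index_iota 1 B.+1].

Lemma mem_int_ball B a : (a \in int_ball B) = (`|a| <= B)%N.
Proof.
rewrite inE mem_cat; apply/idP/idP.
  case/or3P => [/eqP -> //|/mapP[n]|/mapP[n]]; rewrite mem_index_iota => nB ->; lia.
move=> aB; have [->//|a0] := eqVneq a 0; rewrite /=.
have nB : `|a|%N \in index_iota 1 B.+1 by rewrite mem_index_iota; lia.
have [a1|a1] := ltP a 0; apply/orP; [right|left]; apply/mapP; exists `|a|%N => //; lia.
Qed.

Lemma uniq_int_ball B : uniq (int_ball B).
Proof.
rewrite /= cat_uniq !map_inj_uniq ?iota_uniq /=; try by move=> x y; lia.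
rewrite mem_cat negb_or andbT; apply/andP; split; last first.
  by apply/hasPn => a /mapP[n]; rewrite mem_index_iota => nB ->; apply/mapP => -[m]; rewrite mem_index_iota; lia.
by apply/andP; split; apply/mapP => -[m]; rewrite mem_index_iota; lia.
Qed.

Definition int_box B := [seq (a, b) | a <- int_ball B, b <- int_ball B].

Lemma uniq_int_box B : uniq (int_box B).
Proof. by apply: allpairs_uniq; rewrite ?uniq_int_ball // => -[a b] [c e]. Qed.

Lemma mem_int_box B z : (z \in int_box B) = (`|z.1| <= B)%N && (`|z.2| <= B)%N.
Proof.
case: z => a b; rewrite -!mem_int_ball; apply/allpairsP/andP => [[[x y] /= [xB yB [-> ->]]] //|[aB bB]].
by exists (a, b).
Qed.

(** Counting inside a fixed finite box replaces counting in all of Z^2; maps between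
sets of lattice points have to stay in the box. *)
Lemma leq_count_int_box B (P Q : pred (int * int)) f :
  (forall z, z \in int_box B -> P z -> f z \in int_box B /\ Q (f z)) ->
  {in int_box B &, forall z y, P z -> P y -> f z = f y -> z = y} ->
  (count P (int_box B) <= count Q (int_box B))%N.
Proof.
move=> fQ fI; rewrite -!size_filter -(size_map f); apply: uniq_leq_size.
  rewrite map_inj_in_uniq ?filter_uniq ?uniq_int_box // => z y.
  by rewrite !mem_filter => /andP[Pz zB] /andP[Py yB]; apply: fI.
by move=> _ /mapP[z + ->]; rewrite !mem_filter => /andP[Pz zB]; have [-> ->] := fQ z zB Pz.
Qed.

Lemma eq_count_int_box B (P Q : pred (int * int)) f g :
  (forall z, z \in int_box B -> P z -> [/\ f z \in int_box B, Q (f z) & g (f z) = z]) ->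
  (forall z, z \in int_box B -> Q z -> [/\ g z \in int_box B, P (g z) & f (g z) = z]) ->
  count P (int_box B) = count Q (int_box B).
Proof.
move=> fQ gP; apply/eqP; rewrite eqn_leq.
apply/andP; split; [apply: (leq_count_int_box (f := f))|apply: (leq_count_int_box (f := g))].
- by move=> z zB Pz; have [] := fQ z zB Pz.
- by move=> z y zB yB Pz Py e; have [_ _ <-] := fQ z zB Pz; have [_ _ <-] := fQ y yB Py; rewrite e.
- by move=> z zB Pz; have [] := gP z zB Pz.
- by move=> z y zB yB Pz Py e; have [_ _ <-] := gP z zB Pz; have [_ _ <-] := gP y yB Py; rewrite e.
Qed.

(* The two cases are (d, b) = (1, 2) and (4, 1). Then 1 + b sqrt(-d) has norm 5
   for the form m^2 + d n^2. *)
Variables (d b : nat).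
Hypothesis db : (d * b ^ 2 = 4)%N.

Definition qform (z : int * int) : nat := (`|z.1| ^ 2 + d * `|z.2| ^ 2)%N.

Lemma qformE z : (qform z)%:Z = z.1 ^+ 2 + d%:Z * z.2 ^+ 2.
Proof. by rewrite /qform PoszD PoszM -!abszX !abszE !ger0_norm ?sqr_ge0. Qed.

Lemma d_gt0 : (0 < d)%N. Proof. by move: db; case: d. Qed.

Lemma qform_int_box B z : (qform z <= B)%N -> z \in int_box B.
Proof.
have sq x : (x <= x ^ 2)%N by rewrite -mulnn; case: x => // x; rewrite leq_pmulr.
move=> zB; rewrite mem_int_box; apply/andP; split; apply: leq_trans zB.
  by rewrite (leq_trans (sq _)) ?leq_addr.
by rewrite (leq_trans (sq _)) // (leq_trans _ (leq_addl _ _)) // leq_pmull ?d_gt0.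
Qed.

Lemma dbZ : d%:Z * b%:Z ^+ 2 = 4.
Proof. by rewrite -[RHS]/(Posz 4) -db PoszM -mulnn PoszM expr2. Qed.

(** The Hecke relation at 5 for representation numbers, in additive form.
A vector (m, n) of norm 5 N satisfies n = b m or n = - b m modulo 5, since
n^2 = b^2 m^2 modulo 5. Each of the two congruences cuts out a lattice that is
the image of Z^2 under multiplication by 1 + b sqrt(-d) or by its conjugate,
which multiplies the form by 5; the two lattices meet in 5 Z^2. *)
Lemma count_qform_mul5 N B : (5 * N <= B)%N ->
  (count (fun z => qform z == 5 * N)%N (int_box B) +
   (if 5 %| N then count (fun z => qform z == N %/ 5)%N (int_box B) else 0) =
  2 * count (fun z => qform z == N)%N (int_box B))%N.
Proof.
move=> NB.
pose Lp z := (qform z == 5 * N)%N && (5 %| z.2 - b%:Z * z.1)%Z.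
pose Lm z := (qform z == 5 * N)%N && (5 %| z.2 + b%:Z * z.1)%Z.
have inB z : qform z = (5 * N)%N -> z \in int_box B by move=> e; apply: qform_int_box; rewrite e.
have qB z n : (n <= 5 * N)%N -> qform z = n -> z \in int_box B.
  by move=> nN e; apply: qform_int_box; rewrite e (leq_trans nN).
(* Multiplication by 1 + b sqrt(-d) sends (u, v) to (u - d b v, b u + v). *)
have Lpc : count Lp (int_box B) = count (fun z => qform z == N)%N (int_box B).
  pose k z : int := ((z.2 - b%:Z * z.1) %/ 5)%Z.
  apply: (eq_count_int_box (f := fun z => (z.1 + d%:Z * b%:Z * k z, k z))
     (g := fun z => (z.1 - d%:Z * b%:Z * z.2, b%:Z * z.1 + z.2))).
    move=> [m n] _ /= /andP[/eqP e /dvdzP[l /= el]].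
    have -> : k (m, n) = l by rewrite /k el mulzK.
    have en : n = b%:Z * m + 5 * l by rewrite -(subrK (b%:Z * m) n) el; ring.
    have eq : qform (m + d%:Z * b%:Z * l, l) = N.
      apply/eqP; rewrite -(eqn_pmul2l (_ : 0 < 5)%N) // -e -eqz_nat PoszM !qformE /= en.
      rewrite -subr_eq0; apply/eqP.
      have -> : 5%:Z * ((m + d%:Z * b%:Z * l) ^+ 2 + d%:Z * l ^+ 2) -
        (m ^+ 2 + d%:Z * (b%:Z * m + 5 * l) ^+ 2) =
        (4 - d%:Z * b%:Z ^+ 2) * (m ^+ 2 - 5 * d%:Z * l ^+ 2) by ring.
      by rewrite dbZ; ring.
    split; [by apply: (qB _ N) => //; lia|by rewrite eq|].
    congr (_, _); first by ring.
    have -> : b%:Z * (m + d%:Z * b%:Z * l) + l = b%:Z * m + (d%:Z * b%:Z ^+ 2) * l + l by ring.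
    by rewrite dbZ en; ring.
  move=> [u v] _ /= /eqP e.
  have eq : qform (u - d%:Z * b%:Z * v, b%:Z * u + v) = (5 * N)%N.
    apply/eqP; rewrite -e -eqz_nat PoszM !qformE /= -subr_eq0; apply/eqP.
    have -> : (u - d%:Z * b%:Z * v) ^+ 2 + d%:Z * (b%:Z * u + v) ^+ 2 -
       5%:Z * (u ^+ 2 + d%:Z * v ^+ 2) =
       (d%:Z * b%:Z ^+ 2 - 4) * (u ^+ 2 + d%:Z * v ^+ 2) by ring.
    by rewrite dbZ; ring.
  have el : b%:Z * u + v - b%:Z * (u - d%:Z * b%:Z * v) = v * 5.
    have -> : b%:Z * u + v - b%:Z * (u - d%:Z * b%:Z * v) = (1 + d%:Z * b%:Z ^+ 2) * v by ring.
    by rewrite dbZ; ring.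
  have ek : k (u - d%:Z * b%:Z * v, b%:Z * u + v) = v by rewrite /k /= el mulzK.
  split; [exact: inB| |by rewrite ek; congr (_, _); ring].
  by rewrite /Lp eq eqxx /= el dvdz_mull.
(* Conjugation exchanges the two lattices. *)
have Lmc : count Lm (int_box B) = count Lp (int_box B).
  have qN m n : qform (m, - n) = qform (m, n) by rewrite /qform /= abszN.
  apply: (eq_count_int_box (f := fun z => (z.1, - z.2)) (g := fun z => (z.1, - z.2))).
    move=> [m n] _ /= /andP[/eqP e e5]; rewrite opprK; split=> //.
      by apply: inB; rewrite qN.
    by rewrite /Lp /= qN e eqxx -opprD dvdzE abszN.
  move=> [m n] _ /= /andP[/eqP e e5]; rewrite opprK; split=> //.
    by apply: inB; rewrite qN.
  rewrite /Lm /= qN e eqxx (_ : - n + _ = - (n - b%:Z * m)) ?dvdzE ?abszN //.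
  by rewrite opprB addrC.
(* The product (n - b m)(n + b m) d is the form minus 5 m^2. *)
have LU : count (fun z => qform z == 5 * N)%N (int_box B) = count (predU Lp Lm) (int_box B).
  apply: eq_count => -[m n]; rewrite /= /Lp /Lm; case: eqP => //= e.
  have : (5 %| (n - b%:Z * m) * (n + b%:Z * m) * d%:Z)%Z.
    have -> : (n - b%:Z * m) * (n + b%:Z * m) * d%:Z =
       (m ^+ 2 + d%:Z * n ^+ 2) - (1 + d%:Z * b%:Z ^+ 2) * m ^+ 2 by ring.
    by rewrite -(qformE (m, n)) e dbZ PoszM rpredB // dvdz_mulr.
  rewrite !dvdzE !abszM Euclid_dvdM // Euclid_dvdM // => /orP[/orP[->//|->]|].
    by rewrite orbT.
  by move=> /= /dvdnP[j] dj; move: db; rewrite dj; lia.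
have LI : count (predI Lp Lm) (int_box B) =
    (if 5 %| N then count (fun z => qform z == N %/ 5)%N (int_box B) else 0)%N.
  have q5 m n : qform (m * 5, n * 5) = (25 * qform (m, n))%N.
    by rewrite /qform /= !abszM !expnMn mulnA -mulnDl mulnC.
  have div5 m n : Lp (m, n) -> Lm (m, n) -> exists m' n', m = m' * 5 /\ n = n' * 5.
    move=> /andP[_ /dvdzP[k /= ek]] /andP[_ /dvdzP[l /= el]].
    (* From 2 b m = 5 (l - k) one gets 16 m = 4 d b^2 m = 10 d b (l - k), and
       m = 16 m - 15 m; likewise 2 n = 5 (k + l) and n = 5 n - 4 n. *)
    exists (2 * d%:Z * b%:Z * (l - k) - 3 * m), (n - 2 * k - 2 * l); split; last by lia.
    have : 4 * (d%:Z * b%:Z ^+ 2) * m = 2 * d%:Z * b%:Z * (n + b%:Z * m - (n - b%:Z * m)) by ring.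
    by rewrite dbZ ek el => e; lia.
  case: ifP => N5; last first.
    apply/eqP; rewrite -leqn0 leqNgt -has_count; apply/hasPn => -[m n] _.
    apply/negP => /andP[p1 p2]; have [m' [n' [em en]]] := div5 _ _ p1 p2.
    move: p1; rewrite em en => /andP[/eqP]; rewrite q5 => e _.
    by move: N5; lia.
  apply: (eq_count_int_box (f := fun z => ((z.1 %/ 5)%Z, (z.2 %/ 5)%Z)) (g := fun z => (z.1 * 5, z.2 * 5))).
    move=> [m n] _ /= /andP[p1 p2]; have [m' [n' [em en]]] := div5 _ _ p1 p2.
    move: p1; rewrite em en !mulzK // => /andP[/eqP]; rewrite q5 => e _.
    have eq : qform (m', n') = (N %/ 5)%N by lia.
    by split; [apply: (qB _ (N %/ 5)%N) => //; lia|rewrite eq|].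
  move=> [m n] _ /= /eqP e; rewrite !mulzK //.
  have eq : qform (m * 5, n * 5) = (5 * N)%N by rewrite q5 e; lia.
  split=> //; first exact: inB.
  rewrite /Lp /Lm /= eq eqxx /= mulrA -mulrBl -mulrDl; apply/andP; split; exact: dvdz_mull.
by rewrite -LI LU count_predUI Lmc Lpc mul2n addnn.
Qed.

(** The sum of x^(n^2) over all integers n; working over Z keeps the powers of 2 that
are divided out later. *)
Definition phi : fps int := 1 + theta int predT *+ 2.

Lemma phi_coef m B : (m <= B)%N -> phi m = \sum_(a <- int_ball B) (m == `|a| ^ 2)%N%:R.
Proof.
move=> mB; rewrite /phi fps_coefD fps_coefMn (thetaE _ _ mB) fps_coef1 /int_ball big_cons big_cat /=.
rewrite !big_map mulr2n; congr (_ + (_ + _)).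
by under [RHS]eq_bigr => i do rewrite abszN.
Qed.

Lemma phi_dilate_coef N B : (N <= B)%N ->
  (phi * dilate d phi) N = (count (fun z => qform z == N) (int_box B))%:R.
Proof.
move=> NB; rewrite fps_coefM -sum1_count natr_sum.
transitivity (\sum_(a <- int_ball B) \sum_(c <- int_ball B) (qform (a, c) == N)%:R : int); last first.
  rewrite [RHS]big_mkcond big_allpairs /=; apply: eq_bigr => a _; apply: eq_bigr => c _.
  by case: ifP.
have dE j : (j <= N)%N -> (dilate d phi) j = \sum_(c <- int_ball B) (j == d * `|c| ^ 2)%N%:R.
  move=> jN; rewrite /dilate [LHS]/=; case: ifP => dj.
    rewrite -[LHS]/(phi _) (phi_coef (B := B)); last by rewrite (leq_trans (leq_div _ _)) ?(leq_trans jN).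
    by apply: eq_bigr => c _; rewrite -{2}(divnK dj) mulnC eqn_pmul2l ?d_gt0.
  by rewrite big1 // => c _; case: eqP => // e; rewrite e dvdn_mulr in dj.
under eq_bigr => i _.
  rewrite (phi_coef (B := B)); last by rewrite (leq_trans _ NB) // -ltnS ltn_ord.
  rewrite dE ?leq_subr // big_distrlr /=; over.
rewrite exchange_big; apply: eq_bigr => a _; rewrite exchange_big; apply: eq_bigr => c _ /=.
rewrite /qform /=; have [aN|aN] := leqP (`|a| ^ 2)%N N; last first.
  rewrite big1; first by rewrite (_ : (_ == _) = false) //; lia.
  move=> i _; rewrite (_ : (_ == _) = false) ?mul0r //; have := ltn_ord i; lia.
have lt : (`|a| ^ 2 < N.+1)%N by [].
rewrite (bigD1 (Ordinal lt)) //= big1 ?addr0.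
  by rewrite eqxx mul1r; congr (nat_of_bool _)%:R; lia.
move=> i /eqP ne; case: eqP => [e|]; last by rewrite mul0r.
by case: ne; apply/val_inj.
Qed.

(** Writing V5 for x -> x^5, this is U5 = 2 - V5 on the weight 1 theta series of
m^2 + d n^2: the action of the Hecke operator T5 = U5 + V5, whose eigenvalue is 2 since the class number of the
form is 1 and 5 splits. *)
Lemma hecke_phi : decimate 5 (phi * dilate d phi) =
  (phi * dilate d phi) *+ 2 - dilate 5 (phi * dilate d phi).
Proof.
apply: fpsP => N; rewrite fps_coefD fps_coefN fps_coefMn.
rewrite -[LHS]/((phi * dilate d phi) (5 * N)%N).
rewrite -[dilate 5 _ N]/(if (5 %| N)%N then (phi * dilate d phi) (N %/ 5)%N else 0).
have := @count_qform_mul5 N (5 * N) (leqnn _).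
rewrite !(@phi_dilate_coef _ (5 * N)) ?leqnn //; [|lia|lia].
by case: ifP => _; lia.
Qed.

End Lattice.

(** * Theta relations of level 5 modulo 2 *)

Section Dissection.
Variable R : comNzRingType.

Definition theta_all : fps R := theta R predT.
(** The squares of these n are 1 modulo 5; for theta_sq4 they are 4. *)
Definition theta_sq1 : fps R := theta R [pred n | (n %% 5 == 1) || (n %% 5 == 4)]%N.
Definition theta_sq4 : fps R := theta R [pred n | (n %% 5 == 2) || (n %% 5 == 3)]%N.

Lemma theta_ext (c d : pred nat) : c =1 d -> theta R c = theta R d.
Proof. by move=> cd; apply: fpsP => m /=; apply: eq_bigl. Qed.

Lemma theta_all_split5 : theta_all = dilate 25 theta_all + (theta_sq1 + theta_sq4).
Proof.
rewrite {1}/theta_all (theta_split R predT (dvdn 5)); congr (_ + _).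
  exact: etrans (theta_ext _) (theta_dvd R (isT : (0 < 5)%N)).
rewrite (theta_split R _ [pred n | (n %% 5 == 1) || (n %% 5 == 4)]%N).
by congr (_ + _); apply: theta_ext => n; rewrite /= /dvdn;
  have := ltn_pmod n (isT : (0 < 5)%N); case: (n %% 5)%N => [|[|[|[|[|]]]]].
Qed.

Lemma theta_all_split2 : theta_all = dilate 4 theta_all + theta R odd.
Proof.
rewrite {1}/theta_all (theta_split R predT (dvdn 2)); congr (_ + _).
  exact: etrans (theta_ext _) (theta_dvd R (isT : (0 < 2)%N)).
by apply: theta_ext => n; rewrite /= dvdn2 negbK andbT.
Qed.

Lemma supported_sq1 : supported 5 1 theta_sq1.
Proof.
apply: supported_theta => n; rewrite !inE -modnXm.
by case/orP => /eqP ->.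
Qed.

Lemma supported_sq4 : supported 5 4 theta_sq4.
Proof.
apply: supported_theta => n; rewrite !inE -modnXm.
by case/orP => /eqP ->.
Qed.

Lemma supported_sq1_sqr : supported 5 2 (theta_sq1 * theta_sq1).
Proof. exact: supportedM supported_sq1 supported_sq1. Qed.

Lemma supported_sq4_sqr : supported 5 8 (theta_sq4 * theta_sq4).
Proof. exact: supportedM supported_sq4 supported_sq4. Qed.

Lemma supported_sq1_sq4 : supported 5 5 (theta_sq1 * theta_sq4).
Proof. exact: supportedM supported_sq1 supported_sq4. Qed.

End Dissection.

Section Red.

Definition reduce2 (f : fps int) : Z2x := FPS (fun n => (f n)%:~R).

Fact reduce2_is_zmod_morphism : zmod_morphism reduce2.
Proof. by move=> f g; apply: fpsP => n /=; rewrite intrB. Qed.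
Fact reduce2_is_monoid_morphism : monoid_morphism reduce2.
Proof.
split; first by apply: fpsP => n /=; case: eqP.
move=> f g; apply: fpsP => n; rewrite /= rmorph_sum.
by apply: eq_bigr => i _; exact: intrM.
Qed.

HB.instance Definition _ := GRing.isZmodMorphism.Build _ _ reduce2 reduce2_is_zmod_morphism.
HB.instance Definition _ := GRing.isMonoidMorphism.Build _ _ reduce2 reduce2_is_monoid_morphism.

Lemma reduce2_theta c : reduce2 (theta int c) = theta _ c.
Proof.
apply: fpsP => n; rewrite /= rmorph_sum; apply: eq_bigr => i _.
by case: eqP.
Qed.

Lemma reduce2_dilate k f : reduce2 (dilate k f) = dilate k (reduce2 f).
Proof. by apply: fpsP => n /=; case: ifP. Qed.

Lemma reduce2_decimate k f : reduce2 (decimate k f) = decimate k (reduce2 f).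
Proof. by apply: fpsP. Qed.

End Red.

(** Torsion-freeness, used to divide relations over Z by 8 or 4 before reducing
modulo 2. *)
Lemma fps_int_mulrn_inj (k : nat) (f g : fps int) : (0 < k)%N -> f *+ k = g *+ k -> f = g.
Proof.
move=> k0 e; apply: fpsP => n; have := congr1 (fun h : fps int => h n) e.
by rewrite !fps_coefMn => /eqP; rewrite eqr_pMn2r // => /eqP.
Qed.

Section ThetaRelations.

Local Notation A := (theta_all int).
Local Notation P := (theta_sq1 int).
Local Notation Q := (theta_sq4 int).

Lemma phiE : phi = 1 + A *+ 2. Proof. by []. Qed.

Lemma phi_split5 : phi = dilate 5 (dilate 5 phi) + (P + Q) *+ 2.
Proof.
by rewrite dilate_dilate // /phi -/A raddfD raddfMn /= dilate1 // {1}theta_all_split5 mulrnDl addrA.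
Qed.

Lemma dilate_phi k : (0 < k)%N -> dilate k phi = 1 + dilate k A *+ 2.
Proof. by move=> k0; rewrite /phi -/A raddfD raddfMn /= dilate1. Qed.

(** The part of phi^2 with exponents divisible by 5 is phi(x^25)^2 + 8 P Q, and
phi^2 = 1 + 4 (A + A^2); insert both in the Hecke relation for m^2 + n^2 and
divide by 8. *)
Lemma decimate_sq1_sq4 : decimate 5 (P * Q) = (A + A * A) - dilate 5 (A + A * A).
Proof.
apply: (@fps_int_mulrn_inj 8) => //.
have := @hecke_phi 1 2 erefl.
have -> : dilate 1 phi = phi by apply: fpsP => n /=; rewrite dvd1n divn1.
have e : phi * phi = dilate 5 (dilate 5 phi) * dilate 5 (dilate 5 phi) +
   dilate 5 (dilate 5 phi) * (P *+ 4 + Q *+ 4) + (P * P) *+ 4 + (Q * Q) *+ 4 + (P * Q) *+ 8.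
  by rewrite {1 2}phi_split5; ring.
rewrite {1}e !(decimateMn, decimateD) !decimate_dilateM // dilateK //
  !(decimateMn, decimateD).
rewrite (decimate_eq0 _ (@supported_sq1_sqr _)) //.
rewrite (decimate_eq0 _ (@supported_sq4_sqr _)) // (decimate_eq0 _ (@supported_sq1 _)) // (decimate_eq0 _ (@supported_sq4 _)) //.
rewrite !mul0rn !addr0 mulr0 addr0 dilateM // dilate_phi // phiE => {}e.
rewrite -[LHS](addKr ((1 + dilate 5 A *+ 2) * (1 + dilate 5 A *+ 2))) e.
rewrite dilateD dilateM //; ring.
Qed.

(** The same argument for m^2 + 4 n^2: the classes 0, 1, 4 modulo 5 of 4 n^2 are
those of n^2 with 1 and 4 exchanged, so P pairs with P(x^4) and Q with Q(x^4). *)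
Lemma decimate_sq1_dilate4 : decimate 5 (P * dilate 4 P + Q * dilate 4 Q) =
  (A + dilate 4 A + (A * dilate 4 A) *+ 2) - dilate 5 (A + dilate 4 A + (A * dilate 4 A) *+ 2).
Proof.
apply: (@fps_int_mulrn_inj 4) => //.
have := @hecke_phi 4 1 erefl.
have sP4 : supported 5 4 (dilate 4 P) by exact: (@supported_dilateM _ 5 4 _ _ isT) (@supported_sq1 _).
have sQ4 : supported 5 16 (dilate 4 Q) by exact: (@supported_dilateM _ 5 4 _ _ isT) (@supported_sq4 _).
have e4 : dilate 4 phi = dilate 5 (dilate 20 phi) + (dilate 4 P + dilate 4 Q) *+ 2.
  by rewrite {1}phi_split5 dilateD dilateMn (dilateD _ P Q) !dilate_dilate //.
have e : phi * dilate 4 phi = dilate 5 (dilate 5 phi) * dilate 5 (dilate 20 phi) +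
   dilate 5 (dilate 5 phi) * (dilate 4 P *+ 2 + dilate 4 Q *+ 2) +
   dilate 5 (dilate 20 phi) * (P *+ 2 + Q *+ 2) +
   (P * dilate 4 Q) *+ 4 + (Q * dilate 4 P) *+ 4 + (P * dilate 4 P + Q * dilate 4 Q) *+ 4.
  by rewrite e4 {1}phi_split5; ring.
rewrite {1}e !(decimateMn, decimateD) !decimate_dilateM // dilateK // !(decimateMn, decimateD).
rewrite (decimate_eq0 _ (@supported_sq1 _)) // (decimate_eq0 _ (@supported_sq4 _)) //.
rewrite (decimate_eq0 _ sP4) // (decimate_eq0 _ sQ4) //.
rewrite (decimate_eq0 _ (supportedM (@supported_sq1 _) sQ4)) // (decimate_eq0 _ (supportedM (@supported_sq4 _) sP4)) //.
rewrite !mul0rn !addr0 !mulr0 !addr0 dilateM // dilate_dilate // !dilate_phi // phiE => {}e.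
rewrite -[LHS](addKr ((1 + dilate 5 A *+ 2) * (1 + dilate 20 A *+ 2))) e.
by rewrite !(dilateMn, dilateD) dilateM // dilate_dilate //; ring.
Qed.

Local Notation a := (theta_all 'F_2).
Local Notation p := (theta_sq1 'F_2).
Local Notation q := (theta_sq4 'F_2).

Lemma add_char2 (V : lmodType 'F_2) (f : V) : f + f = 0.
Proof.
rewrite -mulr2n -scaler_nat (_ : 2%:R = 0) ?scale0r //.
exact/eqP.
Qed.

Lemma opp_char2 (V : lmodType 'F_2) (f : V) : - f = f.
Proof. by apply: esym; apply/eqP; rewrite -subr_eq0 opprK add_char2. Qed.

Lemma F2_sqr (c : 'F_2) : c ^+ 2 = c.
Proof. by case: c => [[|[|]]] //= i; apply/val_inj. Qed.

(** Squaring is the Frobenius map, which fixes the coefficients. *)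
Lemma fps_sqr (f : Z2x) : f * f = dilate 2 f.
Proof.
apply: fpsP => n; rewrite -[LHS]/(fps_mul f f n) (@fps_mul_trunc _ n.+1) //.
have ch : 2 \in [pchar {poly 'F_2}] by rewrite pchar_poly pchar_Fp.
rewrite -expr2 /fps_trunc poly_def -(pFrobenius_autE ch) rmorph_sum /= coef_sum.
under eq_bigr => i _.
  rewrite pFrobenius_autE exprZn F2_sqr coefZ -exprM coefXn; over.
case: ifP => [n2|/negbT n2]; last first.
  rewrite big1 // => i _; case: eqP => [e|_]; last by rewrite mulr0.
  by rewrite e dvdn_mull in n2.
have lt : (n %/ 2 < n.+1)%N by rewrite ltnS leq_div.
rewrite (bigD1 (Ordinal lt)) //= divnK // eqxx mulr1 big1 ?addr0 // => i /eqP ne.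
by case: eqP => [e|_]; [case: ne; apply/val_inj; rewrite /= [in RHS]e mulnK|rewrite mulr0].
Qed.

Lemma fps_pow4 (f : Z2x) : f ^+ 4 = dilate 4 f.
Proof. by rewrite (exprM f 2 2) !expr2 !fps_sqr dilate_dilate. Qed.

Lemma dilate_theta_coef k m : (0 < k)%N ->
  dilate k a m = \sum_(1 <= n < m.+1) (m == k * n ^ 2)%N%:R.
Proof.
move=> k0; rewrite -[LHS]/(if (k %| m)%N then a (m %/ k)%N else 0).
case: ifP => km.
  rewrite /theta_all (@thetaE _ _ _ m) ?leq_div //; apply: eq_bigr => j _.
  by rewrite -{2}(divnK km) mulnC eqn_pmul2l.
rewrite big1 // => j _; rewrite (_ : (_ == _) = false) //.
by apply/negbTE/negP => /eqP e; rewrite e dvdn_mulr in km.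
Qed.

Lemma r_theta : r = a + dilate 2 a + dilate 5 a + dilate 10 a.
Proof.
apply: fpsP => m; rewrite !fps_coefD !dilate_theta_coef // /r /theta_all -!big_split /=.
by apply: eq_bigr => n _.
Qed.

(** Reduction modulo 2 of the relation for m^2 + n^2, since r = A + A^2 + A(x^5) + A(x^5)^2. *)
Lemma sq1_sq4_r : p * q = dilate 5 r.
Proof.
have := congr1 reduce2 decimate_sq1_sq4.
rewrite reduce2_decimate !(rmorphB, rmorphD, rmorphM) /= reduce2_dilate rmorphD rmorphM /= !reduce2_theta.
rewrite -/a -/p -/q fps_sqr dilateD opp_char2 dilate_dilate // !addrA -r_theta => <-.
by rewrite dilate_decimate //; exact: supported_sq1_sq4.
Qed.

Lemma r_sqr_theta : r + r ^+ 2 = a + dilate 4 a + (dilate 5 a + dilate 5 (dilate 4 a)).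
Proof.
rewrite expr2 fps_sqr r_theta !dilateD !dilate_dilate //.
rewrite -[(2 * 2)%N]/4%N -[(2 * 5)%N]/10%N -[(2 * 10)%N]/20%N -[(5 * 4)%N]/20%N.
transitivity (a + dilate 4 a + (dilate 5 a + dilate 20 a) + (dilate 2 a + dilate 2 a) +
  (dilate 10 a + dilate 10 a)); first by ring.
by rewrite !add_char2 !addr0.
Qed.

(** Reduction modulo 2 of the relation for m^2 + 4 n^2, with P(x^4) = P^4. *)
Lemma sq1_sq4_pow5 : p ^+ 5 + q ^+ 5 = dilate 5 (r + r ^+ 2).
Proof.
have := congr1 reduce2 decimate_sq1_dilate4.
have e0 : reduce2 (A + dilate 4 A + (A * dilate 4 A) *+ 2) = a + dilate 4 a.
  by rewrite mulr2n !rmorphD /= add_char2 addr0 reduce2_dilate reduce2_theta.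
rewrite reduce2_decimate rmorphB /= reduce2_dilate e0 rmorphD !rmorphM /= !reduce2_dilate !reduce2_theta.
rewrite -/a -/p -/q opp_char2 -(fps_pow4 p) -(fps_pow4 q) -!exprS => e.
rewrite -[LHS](@dilate_decimate _ 5) //; last first.
  apply: supportedD; rewrite exprS fps_pow4.
    exact: supportedM (@supported_sq1 _) (@supported_dilateM _ 5 4 _ _ isT (@supported_sq1 _)).
  exact: supportedM (@supported_sq4 _) (@supported_dilateM _ 5 4 _ _ isT (@supported_sq4 _)).
by rewrite e r_sqr_theta -dilateD.
Qed.

(** The five terms have exponents in the five classes modulo 5, in the order
0, 1, 4, 2, 3. *)
Lemma r_split : r = p * q + p + q + p ^+ 2 + q ^+ 2.
Proof.
rewrite sq1_sq4_r {1}r_theta {1 2}theta_all_split5 r_theta !dilateD !dilate_dilate // !expr2 !fps_sqr.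
ring.
Qed.

(** By r_sqr_theta the even squares cancel, because A + A(x^4) is the sum over odd n. *)
Lemma r_sqr_r_even n : ~~ odd n -> (r ^+ 2 + r) n = 0.
Proof.
have so : supported 2 1 (theta 'F_2 odd).
  by apply: supported_theta => m om; rewrite inE !modn2 oddX /= (om : odd m).
have -> : r ^+ 2 + r = theta 'F_2 odd + dilate 5 (theta 'F_2 odd).
  have e : theta 'F_2 odd = a + dilate 4 a.
    by rewrite {1}(theta_all_split2 'F_2) -addrA addrC -addrA add_char2 addr0.
  by rewrite (addrC (r ^+ 2)) r_sqr_theta -dilateD e.
move=> n2; rewrite fps_coefD so ?(supported_dilateM _ so) ?addr0 // modn2 (negPf n2) //.
Qed.

End ThetaRelations.

(** * U5 on the powers of r *)

(** Ring identities in characteristic 2 are proved as identities over Z with an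
explicit witness c of the even difference. *)
Lemma eq_char2 (V : lmodType 'F_2) (x y c : V) : x = y + (c + c) -> x = y.
Proof. by rewrite add_char2 addr0. Qed.

Lemma sqrD2 (R : comAlgType 'F_2) (x y : R) : (x + y) ^+ 2 = x ^+ 2 + y ^+ 2.
Proof. by apply: (@eq_char2 _ _ _ (x * y)); ring. Qed.

Lemma pow4D2 (R : comAlgType 'F_2) (x y : R) : (x + y) ^+ 4 = x ^+ 4 + y ^+ 4.
Proof. by rewrite (exprM _ 2 2) !sqrD2 -!exprM. Qed.

Lemma newton5 (R : comAlgType 'F_2) (x y : R) :
  (x + y) ^+ 5 + (x + y) ^+ 3 * (x * y) + (x + y) * (x * y) ^+ 2 = x ^+ 5 + y ^+ 5.
Proof.
apply: (@eq_char2 _ _ _ (3 * x ^+ 4 * y + 7 * x ^+ 3 * y ^+ 2 +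
  7 * x ^+ 2 * y ^+ 3 + 3 * x * y ^+ 4)).
ring.
Qed.

Lemma U5_decimate f : U5 f = decimate 5 f. Proof. by []. Qed.

Fact U5_is_linear : linear U5.
Proof. by move=> c f g; apply: fpsP => n. Qed.
HB.instance Definition _ := GRing.isLinear.Build _ _ _ _ U5 U5_is_linear.

Section U5OnPowers.

Local Notation p := (theta_sq1 'F_2).
Local Notation q := (theta_sq4 'F_2).

Lemma U5D f g : U5 (f + g) = U5 f + U5 g. Proof. exact: raddfD. Qed.

Lemma U5_sqr f : U5 (f ^+ 2) = U5 f ^+ 2.
Proof.
rewrite !expr2 !fps_sqr; apply: fpsP => n /=.
rewrite Gauss_dvdr //; case: ifP => // n2; congr (f _).
by rewrite muln_divA.
Qed.

(** The modular equation F(x^5) = G. With R = P Q = r(x^5) and s = P + Q one has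
r = R + s + s^2, and the fifth power relation becomes
s^5 + s^3 R + s R^2 + R + R^2 = 0. Modulo this polynomial in s,
r^5 (r + 1) equals R (R + 1)^5. *)
Lemma G_dilate_F : G = dilate 5 F.
Proof.
have dX f k : dilate 5 (f ^+ k) = dilate 5 f ^+ k.
  by elim: k => [|k IH]; rewrite ?dilate1 // !exprS dilateM // IH.
have := sq1_sq4_pow5; rewrite dilateD dX /G /F dilateM // dX dilateD dilate1 // -sq1_sq4_r => e.
set R : Z2x := p * q in e *; set s : Z2x := p + q.
have es : s ^+ 5 + s ^+ 3 * R + s * R ^+ 2 + R + R ^+ 2 = 0.
  by rewrite -addrA -e -newton5 add_char2.
have er : r = R + s + s ^+ 2 by rewrite r_split /s /R sqrD2; ring.
clear e; clearbody R s.
have -> : r ^+ 5 * (r + 1) = (r ^+ 2 + r) * r ^+ 4 by ring.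
have -> : r ^+ 2 + r = R ^+ 2 + R + s + s ^+ 4.
  by rewrite er !sqrD2; apply: (@eq_char2 _ _ _ (s ^+ 2)); ring.
have -> : r ^+ 4 = R ^+ 4 + s ^+ 4 + s ^+ 8 by rewrite er !pow4D2; ring.
(* Division with remainder in s of the difference of the two sides by the relation
   es gives the quotient below and the remainder 2 c. *)
pose c := - R - 3 * R ^+ 2 - 5 * R ^+ 3 - 5 * R ^+ 4 - 2 * R ^+ 5
  - s * (R ^+ 2 + R ^+ 3) - s ^+ 2 * (R ^+ 3 + R ^+ 4)
  - s ^+ 3 * (R + R ^+ 2 + R ^+ 3 + R ^+ 4) - s ^+ 4 * (R ^+ 2 + R ^+ 3)
  - s ^+ 5 * (R ^+ 2 + R ^+ 3) - s ^+ 6 * (R + R ^+ 2 + R ^+ 3)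
  - s ^+ 7 * (R + R ^+ 2) - s ^+ 8 * R ^+ 2 - s ^+ 10 * R.
apply: (@eq_char2 _ _ _ c).
rewrite -[RHS]addr0 -[X in _ = _ + X](mul0r (1 + s * (R + R ^+ 2) + s ^+ 2 * R ^+ 2 +
  s ^+ 3 * (1 + R + R ^+ 2) + s ^+ 4 + s ^+ 5 * R + s ^+ 7)) -es /c.
ring.
Qed.

(** Semilinearity of U5 along G -> F. *)
Lemma U5_mulG f : U5 (G * f) = F * U5 f.
Proof. by rewrite G_dilate_F !U5_decimate decimate_dilateM. Qed.

Lemma supportedX c k f (R : comNzRingType) (g : fps R) :
  supported k c g -> supported k (f * c) (g ^+ f).
Proof.
move=> cg; elim: f => [|f IH]; last by rewrite exprS mulSn; apply: supportedM cg IH.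
by rewrite expr0 => n; rewrite mul0n fps_coef1; case: n; rewrite ?eqxx.
Qed.

Lemma supported_monomial i j : supported 5 (i + 4 * j) (p ^+ i * q ^+ j).
Proof.
rewrite -{1}(muln1 i) [(4 * j)%N]mulnC.
by apply: supportedM; apply: supportedX; [exact: supported_sq1|exact: supported_sq4].
Qed.

Lemma U5_monomial i j : ((i + 4 * j) %% 5 != 0)%N -> U5 (p ^+ i * q ^+ j) = 0.
Proof. by move=> ij; apply: decimate_eq0 (@supported_monomial i j). Qed.

Lemma U5_r : U5 r = r.
Proof.
have := U5_monomial; rewrite {1}r_split sq1_sq4_r => U0.
rewrite !raddfD /= [U5 (dilate 5 r)]dilateK //.
have := U0 1 0; rewrite mulr1 => -> //; have := U0 0 1; rewrite mul1r => -> //.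
have := U0 2 0; rewrite mulr1 => -> //; have := U0 0 2; rewrite mul1r => -> //.
by rewrite !addr0.
Qed.

(** Only (P Q)^3 + P^5 + Q^5 has exponents divisible by 5 among the terms of the
expansion of r r^2. *)
Lemma U5_r3 : U5 (r ^+ 3) = r ^+ 3 + r ^+ 2 + r.
Proof.
have r2 : r ^+ 2 = p ^+ 2 * q ^+ 2 + p ^+ 2 + q ^+ 2 + p ^+ 4 + q ^+ 4.
  by rewrite r_split !sqrD2; ring.
(* Exponents (i, j) of the monomials P^i Q^j killed by U5, that is with
   i + 4 j prime to 5. *)
pose s : seq (nat * nat) := [:: (6, 0); (1, 5); (3, 2); (2, 1); (0, 4); (3, 1); (1, 4);
  (0, 3); (1, 3); (4, 1); (3, 0); (0, 6); (5, 1); (2, 3); (1, 2); (4, 0)]%N.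
have U5s : U5 (\sum_(ij <- s) p ^+ ij.1 * q ^+ ij.2) = 0.
  rewrite linear_sum big1_seq // => ij /andP[_ ijs]; apply: U5_monomial.
  by move: ij ijs; apply/allP.
have e3 : r ^+ 3 = (p * q) ^+ 3 + (p ^+ 5 + q ^+ 5) + \sum_(ij <- s) p ^+ ij.1 * q ^+ ij.2.
  rewrite exprS r2 {1}r_split /s !big_cons big_nil /=.
  by apply: (@eq_char2 _ _ _ (p ^+ 2 * q ^+ 2 + p ^+ 4 * q ^+ 2 + p ^+ 2 * q ^+ 4)); ring.
rewrite {1}e3 U5D U5s addr0 sq1_sq4_r sq1_sq4_pow5.
rewrite (_ : dilate 5 r ^+ 3 + _ = dilate 5 (r ^+ 3 + r ^+ 2 + r)) ?[U5 (dilate 5 _)]dilateK //.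
by rewrite !dilateD !exprS !expr0 !mulr1 !dilateM //; ring.
Qed.

Lemma r_pow6 : r ^+ 6 = r ^+ 5 + G.
Proof. by rewrite /G; apply: (@eq_char2 _ _ _ (- r ^+ 5)); ring. Qed.

(** From r^6 = r^5 + G and U5 (r^6) = (U5 (r^3))^2. *)
Lemma U5_r5 : U5 (r ^+ 5) = r ^+ 5 + r ^+ 4 + r.
Proof.
have e5 : r ^+ 5 = (r ^+ 3) ^+ 2 + G * 1.
  by rewrite -exprM r_pow6 mulr1 -addrA add_char2 addr0.
have U1 : U5 1 = 1 by rewrite -{1}(dilate1 _ (isT : (0 < 5)%N)) U5_decimate dilateK.
rewrite {1}e5 U5D U5_sqr U5_mulG U5_r3 U1 mulr1 !sqrD2 /F.
by apply: (@eq_char2 _ _ _ (r ^+ 6 + 2 * r ^+ 5 + 5 * r ^+ 4 + 5 * r ^+ 3 + 3 * r ^+ 2)); ring.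
Qed.

End U5OnPowers.

(** * Linear combinations and orders of vanishing *)

Section LinComb.
Variable V : lmodType 'F_2.
Implicit Types (v : nat -> V) (c d : {poly 'F_2}).

(** A polynomial serves as a finitely supported family of coefficients. *)
Definition lincomb v c : V := \sum_(k < size c) c`_k *: v k.

Lemma lincomb_widen v c n : (size c <= n)%N -> lincomb v c = \sum_(k < n) c`_k *: v k.
Proof.
move=> cn; rewrite /lincomb -!(big_mkord predT (fun k => c`_k *: v k)).
rewrite (@big_cat_nat _ _ _ (size c) 0 n) //= [X in _ = _ + X]big1_seq ?addr0 //.
move=> k; rewrite mem_index_iota => /andP[_ /andP[ck _]].
by rewrite nth_default // scale0r.
Qed.

Fact lincomb_is_linear v : linear (lincomb v).
Proof.
move=> a c d; pose n := maxn (size c) (size d).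
have cn : (size c <= n)%N by rewrite leq_maxl.
have dn : (size d <= n)%N by rewrite leq_maxr.
have sn : (size (a *: c + d)%R <= n)%N.
  rewrite (leq_trans (size_polyD _ _)) // geq_max dn andbT.
  by rewrite (leq_trans (size_scale_leq _ _)).
rewrite !(lincomb_widen _ cn, lincomb_widen _ dn, lincomb_widen _ sn) scaler_sumr -big_split /=.
by apply: eq_bigr => k _; rewrite coefD coefZ scalerDl scalerA.
Qed.
HB.instance Definition _ v := GRing.isLinear.Build _ _ _ _ (lincomb v) (lincomb_is_linear v).

Lemma lincombXn v k : lincomb v 'X^k = v k.
Proof.
rewrite /lincomb size_polyXn big_ord_recr /= coefXn eqxx scale1r big1 ?add0r // => i _.
by rewrite coefXn ltn_eqF ?scale0r.
Qed.

Lemma lincombZXn v a k : lincomb v (a *: 'X^k) = a *: v k.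
Proof. by rewrite linearZ /= lincombXn. Qed.

End LinComb.

Lemma linear_lincomb (V W : lmodType 'F_2) (f : {linear V -> W}) v c :
  f (lincomb v c) = lincomb (fun k => f (v k)) c.
Proof. by rewrite linear_sum; apply: eq_bigr => k _; rewrite linearZ. Qed.

Lemma horner_alg_lincomb (R : comAlgType 'F_2) (a : R) c :
  horner_alg a c = lincomb (fun k => a ^+ k) c.
Proof.
rewrite [LHS]horner_coef size_map_poly; apply: eq_bigr => k _.
by rewrite coef_map /= mulr_algl.
Qed.

(** Order of vanishing at x = 0; the leading coefficient is then 1. *)
Definition has_ord k (f : Z2x) := (forall n, (n < k)%N -> f n = 0) /\ f k = 1.

Lemma has_ordM k l f g : has_ord k f -> has_ord l g -> has_ord (k + l) (f * g).
Proof.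
move=> [f0 f1] [g0 g1]; split=> [n nkl|].
  rewrite fps_coefM big1 // => i _; have [ik|ik] := ltnP i k; first by rewrite f0 ?mul0r.
  by rewrite g0 ?mulr0 // ltn_subLR 1?(leq_trans nkl) ?leq_add2r // -ltnS ltn_ord.
have lt : (k < (k + l).+1)%N by rewrite ltnS leq_addr.
rewrite fps_coefM (bigD1 (Ordinal lt)) //= f1 mul1r addKn g1 big1 ?addr0 // => i ne.
have ik : (i != k :> nat) by apply: contra ne => /eqP e; apply/eqP/val_inj.
have [ik'|ik'] := ltnP i k; first by rewrite f0 ?mul0r.
by rewrite g0 ?mulr0 //; have := ltn_ord i; lia.
Qed.

Lemma has_ord1 : has_ord 0 1. Proof. by []. Qed.

Lemma has_ordX k f n : has_ord k f -> has_ord (n * k) (f ^+ n).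
Proof.
move=> fk; elim: n => [|n IH]; first exact: has_ord1.
by rewrite exprS mulSn; apply: has_ordM.
Qed.

Lemma has_ord_r : has_ord 1 r.
Proof.
split => [[|n] // _|]; first by rewrite /= big_geq.
by rewrite /= big_nat1; apply/val_inj.
Qed.

Lemma has_ord_r1 : has_ord 0 (r + 1).
Proof. by split => //; rewrite fps_coefD has_ord_r.1 // add0r. Qed.

Lemma has_ord_F : has_ord 1 F.
Proof. exact: has_ordM has_ord_r (has_ordX 5 has_ord_r1). Qed.

Lemma has_ord_G : has_ord 5 G.
Proof. exact: has_ordM (has_ordX 5 has_ord_r) has_ord_r1. Qed.

Lemma fps_sumE (I : Type) (s : seq I) (P : pred I) (f : I -> Z2x) k :
  (\sum_(i <- s | P i) f i) k = \sum_(i <- s | P i) f i k.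
Proof. by elim/big_rec2: _ => // i x y _ <-. Qed.

(** Elements of pairwise distinct orders are linearly independent: the coefficient
at the smallest order in the support cannot cancel. *)
Lemma has_ord_indep (o : nat -> nat) (v : nat -> Z2x) (c : {poly 'F_2}) :
  (forall k, c`_k != 0 -> has_ord (o k) (v k)) ->
  (forall j k, c`_j != 0 -> c`_k != 0 -> o j = o k -> j = k) ->
  lincomb v c = 0 -> c = 0.
Proof.
move=> vo oI c0; apply/eqP; apply: contraT => /eqP cN.
pose A n := [exists k : 'I_(size c), (c`_k != 0) && (o k == n)].
have A0 : exists n, A n.
  have sc : (0 < size c)%N by rewrite size_poly_gt0; apply/eqP.
  exists (o (size c).-1); apply/existsP.
  exists (Ordinal (etrans (congr1 (fun x => x <= size c)%N (prednK sc)) (leqnn _))).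
  by rewrite /= eqxx andbT -lead_coefE lead_coef_eq0; apply/eqP.
case: (ex_minnP A0) => n /existsP[k /andP[ck /eqP ok]] nmin.
have : lincomb v c n = 0 by rewrite c0.
rewrite /lincomb fps_sumE (bigD1 k) // fps_coefZ -ok (vo k ck).2 mulr1 big1.
  by move=> e; move: ck; rewrite -[c`_k]addr0 (e : c`_k + 0 = 0) eqxx.
move=> i /andP[_ ik]; rewrite fps_coefZ; have [->|ci] := eqVneq c`_i 0; first by rewrite mul0r.
rewrite (vo i ci).1 ?mulr0 // ltn_neqAle ok nmin ?andbT; last first.
  by apply/existsP; exists i; rewrite ci eqxx.
by apply: contra ik => /eqP e; apply/eqP/val_inj/oI => //; rewrite ok.
Qed.

Lemma fps_mulIG f : f * G = 0 -> f = 0.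
Proof.
move=> fG; apply: fpsP => n /=; elim/ltn_ind: n => n IH.
have : (f * G) (n + 5)%N = 0 by rewrite fG.
rewrite fps_coefM.
have lt : (n < (n + 5).+1)%N by lia.
have [G0 G1] := has_ord_G.
rewrite (bigD1 (Ordinal lt)) // [nat_of_ord _]/= addKn G1 mulr1 big1.
  by move=> e; rewrite -[f n]addr0; exact: e.
move=> i /andP[_ ne]; have ik : (i != n :> nat) by apply: contra ne => /eqP e; apply/eqP/val_inj.
have [ik'|ik'] := ltnP i n; first by rewrite IH ?mul0r.
by rewrite G0 ?mulr0 //; have := ltn_ord i; lia.
Qed.

(** * The involution r -> r + 1 and the twisted trace *)

Local Notation ev := (horner_alg r).

Lemma horner_algZ (a : Z2x) c h : horner_alg a (c *: h) = c *: horner_alg a h.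
Proof. by rewrite linearZ /= mulr_algl. Qed.

Lemma evD g h : ev (g + h) = ev g + ev h. Proof. exact: rmorphD. Qed.
Lemma evM g h : ev (g * h) = ev g * ev h. Proof. exact: rmorphM. Qed.
Lemma evX g n : ev (g ^+ n) = ev g ^+ n. Proof. exact: rmorphXn. Qed.

(** The series r has order 1, so it is transcendental and identities between
polynomials in r can be lifted to Z/2[X]. *)
Lemma ev_inj : injective ev.
Proof.
move=> g h e; apply/eqP; rewrite -subr_eq0; apply/eqP.
apply: (@has_ord_indep id (fun k => r ^+ k)); [|by []|].
  by move=> k _; rewrite -{1}(muln1 k); apply: has_ordX has_ord_r.
by rewrite -horner_alg_lincomb rmorphB /= e subrr.
Qed.

(** The Atkin-Lehner involution: it fixes t = F + G and exchanges F and G. *)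
Definition atkin (h : {poly 'F_2}) := h \Po ('X + 1).

Lemma comp_alg (h g : {poly 'F_2}) (a : Z2x) :
  horner_alg a (h \Po g) = horner_alg (horner_alg a g) h.
Proof.
rewrite comp_polyE linear_sum horner_alg_lincomb; apply: eq_bigr => k _.
by rewrite linearZ /= mulr_algl rmorphXn.
Qed.

Lemma ev_atkin h : ev (atkin h) = horner_alg (r + 1) h.
Proof. by rewrite comp_alg rmorphD rmorph1 /= horner_algX. Qed.

Lemma atkinK : involutive atkin.
Proof.
move=> h; rewrite /atkin -comp_polyA comp_polyD comp_polyX comp_polyC polyC1.
by rewrite -addrA add_char2 addr0 comp_polyXr.
Qed.

Definition tpol : {poly 'F_2} := 'X^2 + 'X.
Definition Gpol : {poly 'F_2} := 'X^5 * ('X + 1).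
Definition Fpol : {poly 'F_2} := 'X * ('X + 1) ^+ 5.

Lemma ev_tpol : ev tpol = r ^+ 2 + r. Proof. by rewrite rmorphD rmorphXn /= !horner_algX. Qed.
Lemma ev_Gpol : ev Gpol = G.
Proof. by rewrite rmorphM rmorphXn rmorphD rmorph1 /= !horner_algX. Qed.
Lemma ev_Fpol : ev Fpol = F.
Proof. by rewrite rmorphM rmorphXn rmorphD rmorph1 /= !horner_algX. Qed.

Lemma atkinM g h : atkin (g * h) = atkin g * atkin h. Proof. exact: comp_polyM. Qed.
Lemma atkinD g h : atkin (g + h) = atkin g + atkin h. Proof. exact: comp_polyD. Qed.
Lemma atkinXn g n : atkin (g ^+ n) = atkin g ^+ n. Proof. exact: rmorphXn. Qed.
Lemma atkinX : atkin 'X = 'X + 1. Proof. exact: comp_polyX. Qed.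
Lemma atkin1 : atkin 1 = 1. Proof. exact: comp_polyC. Qed.

Lemma atkin_tpol : atkin tpol = tpol.
Proof.
rewrite atkinD atkinXn atkinX /tpol.
by apply: (@eq_char2 _ _ _ ('X + 1)); ring.
Qed.

Lemma atkin_Gpol : atkin Gpol = Fpol.
Proof.
rewrite atkinM atkinXn atkinD atkinX atkin1 /Fpol.
by apply: (@eq_char2 _ _ _ (('X + 1) ^+ 5)); ring.
Qed.

Lemma atkin_Fpol : atkin Fpol = Gpol. Proof. by rewrite -atkin_Gpol atkinK. Qed.

(** The difference between U5 and the involution. The roots of Y^6 + Y^5 + G over
Z/2(G) are the five series r(zeta x) with zeta^5 = 1 and 1 + r(x^5); hence the trace
of h(r) down to Z/2(G) is (U5 h(r))(x^5) + h(1 + r(x^5)), and the defect is its image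
under G -> F. *)
Definition defect h : Z2x := U5 (ev h) + ev (atkin h).

Fact defect_is_linear : linear defect.
Proof.
move=> a g h; rewrite /defect /atkin comp_polyD comp_polyZ !rmorphD /= !horner_algZ.
by rewrite U5D [U5 (_ *: _)]linearZ /= scalerDr addrACA.
Qed.
HB.instance Definition _ := GRing.isLinear.Build _ _ _ _ defect defect_is_linear.

(** The involution and U5 both turn multiplication by G into multiplication by F. *)
Lemma defectG h : defect (Gpol * h) = F * defect h.
Proof.
by rewrite /defect atkinM atkin_Gpol (rmorphM _ Gpol) (rmorphM _ Fpol) /= ev_Gpol ev_Fpol U5_mulG mulrDr.
Qed.

Lemma ev_atkinXn n : ev (atkin 'X^n) = (r + 1) ^+ n.
Proof. by rewrite ev_atkin rmorphXn /= horner_algX. Qed.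

Lemma defectXn n : defect 'X^n = U5 (r ^+ n) + (r + 1) ^+ n.
Proof. by rewrite /defect ev_atkinXn rmorphXn /= horner_algX. Qed.

Lemma defect1 : defect 1 = 0.
Proof.
have := defectXn 0; rewrite !expr0 => ->.
by rewrite -{1}(dilate1 _ (isT : (0 < 5)%N)) U5_decimate dilateK // add_char2.
Qed.

Lemma defectX : defect 'X = 1.
Proof. by rewrite -['X]expr1 defectXn !expr1 U5_r addrA add_char2 add0r. Qed.

Lemma defectX2 : defect 'X^2 = 1.
Proof. by rewrite defectXn U5_sqr U5_r sqrD2 addrA add_char2 add0r expr1n. Qed.

Lemma defectX4 : defect 'X^4 = 1.
Proof. by rewrite defectXn (exprM r 2 2) !U5_sqr U5_r pow4D2 -exprM addrA add_char2 add0r expr1n. Qed.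

Lemma defectX3 : defect 'X^3 = 1.
Proof.
rewrite defectXn U5_r3.
by apply: (@eq_char2 _ _ _ (r ^+ 3 + 2 * r ^+ 2 + 2 * r)); ring.
Qed.

Lemma defectX5 : defect 'X^5 = 1.
Proof.
rewrite defectXn U5_r5.
by apply: (@eq_char2 _ _ _ (r ^+ 5 + 3 * r ^+ 4 + 5 * r ^+ 3 + 5 * r ^+ 2 + 3 * r)); ring.
Qed.

(** The equation of degree 6 of r over Z/2[G]. *)
Lemma X_pow6 n : 'X^(n + 6) = 'X^(n + 5) + Gpol * 'X^n :> {poly 'F_2}.
Proof.
by rewrite !exprD; apply: (@eq_char2 _ _ _ (- 'X^n * 'X^5)); rewrite /Gpol; ring.
Qed.

(** By the equation of degree 6 the powers of X obey a linear recurrence over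
Z/2[G], and the first six have defect 0 or 1. *)
Lemma defect_hornerF h : exists c, defect h = horner_alg F c.
Proof.
suff X n : exists c, defect 'X^n = horner_alg F c.
  rewrite -[h]coefK poly_def linear_sum.
  elim/big_ind: _ => [|x y [c ->] [d ->]|i _].
  - by exists 0; rewrite rmorph0.
  - by exists (c + d); rewrite rmorphD.
  - by have [c e] := X i; exists (h`_i *: c); rewrite linearZ horner_algZ /= e.
elim/ltn_ind: n => n IH; case: (ltnP n 6) => n6.
  case: n n6 {IH} => [_|]; first by exists 0; rewrite rmorph0; exact: defect1.
  by move=> [|[|[|[|[|]]]]] // _; exists 1; rewrite rmorph1 ?defectX ?defectX2 ?defectX3 ?defectX4 ?defectX5.
have [c ec] := IH (n - 6 + 5)%N ltac:(lia); have [d ed] := IH (n - 6)%N ltac:(lia).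
exists (c + 'X * d); rewrite -(subnK n6) X_pow6 linearD /= defectG ec ed.
by rewrite rmorphD rmorphM /= horner_algX.
Qed.

Lemma tpol_pow3 : tpol ^+ 3 = Gpol + 'X^4 + 'X^3.
Proof. by rewrite /tpol /Gpol; apply: (@eq_char2 _ _ _ ('X^5 + 'X^4)); ring. Qed.

Lemma tpol_pow4 : tpol ^+ 4 = 'X^4 + 'X^5 + Gpol * (1 + 'X + 'X^2).
Proof. by rewrite /tpol /Gpol; apply: (@eq_char2 _ _ _ ('X^7 + 'X^6 *+ 2 + 'X^5)); ring. Qed.

Lemma tpol_pow5 : tpol ^+ 5 = Gpol * ('X^4 + 1).
Proof. by rewrite /tpol /Gpol; apply: (@eq_char2 _ _ _ ('X^9 *+ 2 + 'X^8 *+ 5 + 'X^7 *+ 5 + 'X^6 *+ 2)); ring. Qed.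

(** The minimal polynomial of t over Z/2(G) is Y^6 + G Y + G^2, whose Newton sums
vanish up to the fifth, which is 5 G = G. *)
Lemma defect_tpol k : (k < 6)%N -> defect (tpol ^+ k) = if k == 5%N then F else 0.
Proof.
case: k => [|[|[|[|[|[|//]]]]]] _ /=.
- by rewrite expr0 defect1.
- by rewrite expr1 linearD /= defectX defectX2 add_char2.
- by rewrite /tpol sqrD2 -exprM linearD /= defectX4 defectX2 add_char2.
- by rewrite tpol_pow3 !linearD /= defectX4 defectX3 -[Gpol]mulr1 defectG defect1 mulr0 add0r add_char2.
- rewrite tpol_pow4 !linearD /= defectX4 defectX5 add_char2 add0r.
  by rewrite defectG !linearD /= defect1 defectX defectX2 add0r add_char2 mulr0.
by rewrite tpol_pow5 defectG linearD /= defect1 defectX4 addr0 mulr1.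
Qed.

Lemma defect_monomial b k : (k < 6)%N ->
  defect (Gpol ^+ b * tpol ^+ k) = if k == 5%N then F ^+ b.+1 else 0.
Proof.
move=> k6; elim: b => [|b IH]; first by rewrite expr0 mul1r defect_tpol.
by rewrite exprS -mulrA defectG IH; case: ifP; rewrite ?mulr0 // -exprS.
Qed.

(** This is (F + G)^6 = F G, as F G = r^6 (r + 1)^6. *)
Lemma tpol_pow6 : tpol ^+ 6 = Gpol * tpol + Gpol ^+ 2.
Proof.
rewrite /tpol /Gpol.
by apply: (@eq_char2 _ _ _ ('X^11 *+ 2 + 'X^10 *+ 7 + 'X^9 *+ 10 + 'X^8 *+ 7 + 'X^7 *+ 2)); ring.
Qed.

(** * Triangularity of the odd powers of t *)

Lemma lincombMXn (R : comAlgType 'F_2) (v : nat -> R) (g : R) n c :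
  (forall k, v (n + k)%N = g * v k) -> lincomb v ('X^n * c) = g * lincomb v c.
Proof.
move=> vg; rewrite -{1}[c]coefK poly_def mulr_sumr linear_sum [in RHS]/lincomb mulr_sumr.
by apply: eq_bigr => k _; rewrite -scalerAr -exprD /= lincombZXn vg scalerAr.
Qed.

Definition Epol_texp m : nat := nth 0%N [:: 1; 3; 5; 2; 4; 5]%N (m %% 6).
Definition Epol_Gexp m : nat := (4 * (m %/ 6) + nth 0 [:: 0; 0; 0; 1; 1; 2] (m %% 6))%N.
(** Epol runs through the monomials t, t^3, t^5, G t^2, G t^4, G^2 t^5 and their
multiples by powers of G^4, in the order in which they lead the odd powers of t. *)
Definition Epol m : {poly 'F_2} := Gpol ^+ Epol_Gexp m * tpol ^+ Epol_texp m.
(** The monomials G^b t^a with a < 5, numbered by their order 5 b + a at x = 0. *)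
Definition Wpol k : {poly 'F_2} := Gpol ^+ (k %/ 5) * tpol ^+ (k %% 5).

(** For odd k these are the k such that Wpol k lies in N1 or maps to N2b; atype is
the set of those mapping to N2a. *)
Definition btype k := (k %% 20 \in [:: 5; 15; 11; 13; 17; 19])%N.
Definition atype k := (k %% 20 \in [:: 1; 3; 7; 9])%N.

Definition spanW (S : pred nat) (h : {poly 'F_2}) :=
  exists2 c : {poly 'F_2}, (forall k, c`_k != 0 -> S k) & h = lincomb Wpol c.

Lemma spanW0 S : spanW S 0.
Proof. by exists 0; rewrite ?linear0 // => k; rewrite coef0 eqxx. Qed.

Lemma spanWD S g h : spanW S g -> spanW S h -> spanW S (g + h).
Proof.
move=> [c cS ->] [d dS ->]; exists (c + d); rewrite ?linearD // => k.
rewrite coefD; have [->|/cS //] := eqVneq c`_k 0; by rewrite add0r => /dS.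
Qed.

Lemma spanWZ S a h : spanW S h -> spanW S (a *: h).
Proof.
move=> [c cS ->]; exists (a *: c); rewrite ?linearZ // => k.
by rewrite coefZ mulf_eq0 negb_or => /andP[_ /cS].
Qed.

Lemma spanW_sum S (I : eqType) (s : seq I) (f : I -> {poly 'F_2}) :
  (forall i, i \in s -> spanW S (f i)) -> spanW S (\sum_(i <- s) f i).
Proof.
move=> fS; rewrite big_seq; elim/big_ind: _ => //; [exact: spanW0|exact: spanWD].
Qed.

Lemma spanW_Wpol (S : pred nat) k : S k -> spanW S (Wpol k).
Proof.
move=> Sk; exists 'X^k; rewrite ?lincombXn // => j; rewrite coefXn.
by have [->|] := eqVneq j k; rewrite ?eqxx.
Qed.

Lemma spanWM (S : pred nat) h : (forall k, S k -> S (20 + k)%N) ->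
  spanW S h -> spanW S (Gpol ^+ 4 * h).
Proof.
move=> S20 [c cS ->]; exists ('X^20 * c).
  move=> k; rewrite coefXnM; case: ltnP => [|k20 /cS /S20]; first by rewrite eqxx.
  by rewrite subnKC.
rewrite (@lincombMXn _ _ (Gpol ^+ 4)) // => k; rewrite /Wpol.
have -> : ((20 + k) %/ 5 = 4 + k %/ 5)%N by lia.
by rewrite (_ : (20 + k) %% 5 = k %% 5)%N ?exprD ?mulrA //; lia.
Qed.

Lemma btype_add20 k : btype k -> btype (20 + k).
Proof. by rewrite /btype modnDl. Qed.

(** The monomial leading t^(2 m + 1) is Epol m, up to the span of the Wpol k with k
of type b. *)
Definition triangular m := exists2 q : {poly 'F_2}, (size q <= m)%N &
  spanW btype (tpol ^+ (2 * m + 1) - lincomb Epol ('X^m + q)).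

Lemma triangular_intro m (q s : seq nat) : all (gtn m) q -> all btype s ->
  tpol ^+ (2 * m + 1) = Epol m + \sum_(k <- q) Epol k + \sum_(k <- s) Wpol k -> triangular m.
Proof.
move=> /allP qm /allP sb e; exists (\sum_(k <- q) 'X^k).
  apply: (leq_trans (size_sum _ _ _)); apply/bigmax_leqP_seq => k kq _.
  by rewrite size_polyXn; apply: qm.
have Eq : lincomb Epol (\sum_(k <- q) 'X^k) = \sum_(k <- q) Epol k.
  by rewrite linear_sum; apply: eq_bigr => k _; rewrite /= lincombXn.
rewrite e linearD /= lincombXn Eq.
by rewrite addrC addKr; apply: spanW_sum => k /sb; apply: spanW_Wpol.
Qed.

(* Consequences of t^6 = g t + g^2 that start the recursion on the odd powers of t. *)
Section Powers.
Variables (R : comAlgType 'F_2) (t g : R).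
Hypothesis t6 : t ^+ 6 = g * t + g ^+ 2.

Lemma t_pow7 : t ^+ 7 = g ^+ 2 * t + g * t ^+ 2.
Proof. by rewrite (exprD t 6 1) t6; ring. Qed.
Lemma t_pow9 : t ^+ 9 = g ^+ 2 * t ^+ 3 + g * t ^+ 4.
Proof. by rewrite (exprD t 6 3) t6; ring. Qed.
Lemma t_pow11 : t ^+ 11 = g ^+ 2 * t ^+ 5 + g ^+ 2 * t + g ^+ 3.
Proof.
transitivity (g * t ^+ 6 + g ^+ 2 * t ^+ 5).
  by rewrite (exprD t 6 5) {1}t6; ring.
by rewrite t6; ring.
Qed.
Lemma t_pow12 : t ^+ 12 = g ^+ 2 * t ^+ 2 + g ^+ 4.
Proof. by rewrite (exprM t 6 2) t6 sqrD2; ring. Qed.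
Lemma t_pow13 : t ^+ 13 = g ^+ 4 * t + g ^+ 2 * t ^+ 3.
Proof. by rewrite (exprD t 12 1) t_pow12; ring. Qed.
Lemma t_pow15 : t ^+ 15 = g ^+ 4 * t ^+ 3 + g ^+ 2 * t ^+ 5.
Proof. by rewrite (exprD t 12 3) t_pow12; ring. Qed.
Lemma t_pow17 : t ^+ 17 = g ^+ 4 * t ^+ 5 + g ^+ 4 * t + g ^+ 3 * t ^+ 2.
Proof.
transitivity (g ^+ 2 * t ^+ 7 + g ^+ 4 * t ^+ 5).
  by rewrite (exprD t 12 5) {1}t_pow12; ring.
by rewrite t_pow7; ring.
Qed.
Lemma t_pow19 : t ^+ 19 = g ^+ 6 * t + g ^+ 5 * t ^+ 2 + g ^+ 4 * t ^+ 3 + g ^+ 3 * t ^+ 4.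
Proof. rewrite (exprD t 12 7) t_pow12 t_pow7; ring. Qed.
Lemma t_pow21 : t ^+ 21 = g ^+ 6 * t ^+ 3 + g ^+ 5 * t ^+ 4 + g ^+ 4 * t ^+ 5 + g ^+ 4 * t + g ^+ 5.
Proof.
transitivity (g ^+ 6 * t ^+ 3 + g ^+ 5 * t ^+ 4 + g ^+ 4 * t ^+ 5 + g ^+ 3 * t ^+ 6).
  by rewrite (exprD t 12 9) {1}t_pow12 t_pow9; ring.
by rewrite t6; ring.
Qed.
Lemma t_pow23 : t ^+ 23 = g ^+ 6 * t ^+ 5 + g ^+ 4 * t ^+ 3 + g ^+ 7.
Proof.
transitivity (g ^+ 4 * t ^+ 7 + g ^+ 4 * t ^+ 3 + g ^+ 5 * t ^+ 2 + g ^+ 6 * t ^+ 5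
  + g ^+ 6 * t + g ^+ 7).
  by rewrite (exprD t 12 11) {1}t_pow12 t_pow11; ring.
by rewrite t_pow7; apply: (@eq_char2 _ _ _ (g ^+ 6 * t + g ^+ 5 * t ^+ 2)); ring.
Qed.
Lemma t_pow24 : t ^+ 24 = g ^+ 4 * t ^+ 4 + g ^+ 8.
Proof. by rewrite (exprM t 12 2) t_pow12 sqrD2; ring. Qed.

End Powers.

(** The recurrence t^(n + 24) = G^4 t^(n + 4) + G^8 t^n has coefficients in Z/2[G^4],
over which Epol and both types are periodic: G^4 shifts m by 6 and k by 20. So the
exponent 2 m + 1 follows from m - 10 and m - 12 and the claim reduces to m < 12. *)
Lemma t_pow_triangular m : triangular m.
Proof.
have t6 := tpol_pow6.
elim/ltn_ind: m => m IH.
have [m12|m12] := ltnP m 12; last first.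
  have /IH[q1 s1 b1] : (m - 12 < m)%N by lia.
  have /IH[q2 s2 b2] : (m - 10 < m)%N by lia.
  pose n := (m - 12)%N; have em : m = (n + 12)%N by rewrite subnK.
  have e10 : (m - 10 = n + 2)%N by lia.
  rewrite -/n in s1 b1; rewrite e10 in s2 b2.
  (* X^12 (X^n + q1) supplies the leading term X^m. *)
  exists ('X^6 * ('X^(n + 2) + q2) + 'X^12 * q1).
    rewrite em (leq_trans (size_polyD _ _)) // geq_max; apply/andP; split.
      rewrite (leq_trans (size_polyMleq _ _)) // size_polyXn /=.
      have : (size ('X^(n + 2) + q2 : {poly 'F_2})%R <= n + 3)%N.
        by rewrite (leq_trans (size_polyD _ _)) // geq_max size_polyXn; lia.
      by move=> h; apply: leq_trans (_ : 6 + (n + 3) <= _)%N; [rewrite leq_add2l|lia].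
    rewrite (leq_trans (size_polyMleq _ _)) // size_polyXn /=.
    by apply: leq_trans (_ : 12 + n <= _)%N; [rewrite leq_add2l|lia].
  have E6 k : Epol (6 + k) = Gpol ^+ 4 * Epol k.
    rewrite /Epol /Epol_Gexp /Epol_texp (_ : (6 + k) %/ 6 = 1 + k %/ 6)%N; last by lia.
    by rewrite modnDl mulnDr -addnA exprD mulrA.
  have lc6 c : lincomb Epol ('X^6 * c) = Gpol ^+ 4 * lincomb Epol c.
    by rewrite (@lincombMXn _ _ (Gpol ^+ 4)).
  have -> : tpol ^+ (2 * m + 1) - lincomb Epol ('X^m + ('X^6 * ('X^(n + 2) + q2) + 'X^12 * q1)) =
    Gpol ^+ 4 * (tpol ^+ (2 * (n + 2) + 1) - lincomb Epol ('X^(n + 2) + q2)) +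
    Gpol ^+ 4 * (Gpol ^+ 4 * (tpol ^+ (2 * n + 1) - lincomb Epol ('X^n + q1))).
    have -> : 'X^m + ('X^6 * ('X^(n + 2) + q2) + 'X^12 * q1) =
       'X^6 * ('X^(n + 2) + q2) + 'X^6 * ('X^6 * ('X^n + q1)).
      by rewrite em exprD; ring.
    rewrite linearD /= !lc6 em !mulnDr (_ : 2 * n + 2 * 12 + 1 = 2 * n + 1 + 24)%N; last by lia.
    rewrite (exprD _ (2 * n + 1) 24) (t_pow24 t6) (_ : 2 * n + 2 * 2 + 1 = 2 * n + 1 + 4)%N; last by lia.
    rewrite (exprD _ (2 * n + 1) 4); ring.
  by apply: spanWD; apply: spanWM btype_add20 _ => //; apply: spanWM btype_add20 _.
case: m m12 {IH} => [|[|[|[|[|[|[|[|[|[|[|[|//]]]]]]]]]]]] _.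
- apply: (@triangular_intro 0 [::] [::]) => //; rewrite !big_nil.
  rewrite -[Epol 0]/(Gpol ^+ 0 * tpol ^+ 1); ring.
- apply: (@triangular_intro 1 [::] [::]) => //; rewrite !big_nil.
  rewrite -[Epol 1]/(Gpol ^+ 0 * tpol ^+ 3); ring.
- apply: (@triangular_intro 2 [::] [::]) => //; rewrite !big_nil.
  rewrite -[Epol 2]/(Gpol ^+ 0 * tpol ^+ 5); ring.
- apply: (@triangular_intro 3 [::] [:: 11]%N) => //; rewrite !(big_nil, big_cons).
  rewrite -[Epol 3]/(Gpol ^+ 1 * tpol ^+ 2) -[Wpol 11]/(Gpol ^+ 2 * tpol ^+ 1) (t_pow7 t6); ring.
- apply: (@triangular_intro 4 [::] [:: 13]%N) => //; rewrite !(big_nil, big_cons).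
  rewrite -[Epol 4]/(Gpol ^+ 1 * tpol ^+ 4) -[Wpol 13]/(Gpol ^+ 2 * tpol ^+ 3) (t_pow9 t6); ring.
- apply: (@triangular_intro 5 [::] [:: 11; 15]%N) => //; rewrite !(big_nil, big_cons).
  rewrite -[Epol 5]/(Gpol ^+ 2 * tpol ^+ 5) -[Wpol 11]/(Gpol ^+ 2 * tpol ^+ 1).
  rewrite -[Wpol 15]/(Gpol ^+ 3 * tpol ^+ 0) (t_pow11 t6); ring.
- apply: (@triangular_intro 6 [::] [:: 13]%N) => //; rewrite !(big_nil, big_cons).
  rewrite -[Epol 6]/(Gpol ^+ 4 * tpol ^+ 1) -[Wpol 13]/(Gpol ^+ 2 * tpol ^+ 3) (t_pow13 t6); ring.
- apply: (@triangular_intro 7 [:: 5]%N [::]%N) => //; rewrite !(big_nil, big_cons).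
  rewrite -[Epol 7]/(Gpol ^+ 4 * tpol ^+ 3) -[Epol 5]/(Gpol ^+ 2 * tpol ^+ 5) (t_pow15 t6); ring.
- apply: (@triangular_intro 8 [:: 6]%N [:: 17]%N) => //; rewrite !(big_nil, big_cons).
  rewrite -[Epol 8]/(Gpol ^+ 4 * tpol ^+ 5) -[Epol 6]/(Gpol ^+ 4 * tpol ^+ 1).
  rewrite -[Wpol 17]/(Gpol ^+ 3 * tpol ^+ 2) (t_pow17 t6); ring.
- apply: (@triangular_intro 9 [:: 7]%N [:: 31; 19]%N) => //; rewrite !(big_nil, big_cons).
  rewrite -[Epol 9]/(Gpol ^+ 5 * tpol ^+ 2) -[Epol 7]/(Gpol ^+ 4 * tpol ^+ 3).
  rewrite -[Wpol 31]/(Gpol ^+ 6 * tpol ^+ 1) -[Wpol 19]/(Gpol ^+ 3 * tpol ^+ 4) (t_pow19 t6); ring.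
- apply: (@triangular_intro 10 [:: 8; 6]%N [:: 33; 25]%N) => //; rewrite !(big_nil, big_cons).
  rewrite -[Epol 10]/(Gpol ^+ 5 * tpol ^+ 4) -[Epol 8]/(Gpol ^+ 4 * tpol ^+ 5) -[Epol 6]/(Gpol ^+ 4 * tpol ^+ 1).
  rewrite -[Wpol 33]/(Gpol ^+ 6 * tpol ^+ 3) -[Wpol 25]/(Gpol ^+ 5 * tpol ^+ 0) (t_pow21 t6); ring.
- apply: (@triangular_intro 11 [:: 7]%N [:: 35]%N) => //; rewrite !(big_nil, big_cons).
  rewrite -[Epol 11]/(Gpol ^+ 6 * tpol ^+ 5) -[Epol 7]/(Gpol ^+ 4 * tpol ^+ 3).
  rewrite -[Wpol 35]/(Gpol ^+ 7 * tpol ^+ 0) (t_pow23 t6); ring.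
Qed.

(** * The kernel of U5 + I as polynomials in t *)

Lemma char2_eq (V : lmodType 'F_2) (x y : V) : x + y = 0 -> x = y.
Proof. by move/eqP; rewrite addr_eq0 opp_char2 => /eqP. Qed.

Lemma poly_sqr (h : {poly 'F_2}) : h \Po 'X^2 = h ^+ 2.
Proof.
elim/poly_ind: h => [|h c IH]; first by rewrite comp_poly0 expr0n.
rewrite comp_polyD comp_polyM comp_polyX comp_polyC IH sqrD2 exprMn.
by rewrite -rmorphXn F2_sqr.
Qed.

Lemma horner_atkin h a : (atkin h).[a] = h.[a + 1].
Proof. by rewrite horner_comp hornerD hornerX hornerC. Qed.

Lemma tpol_neq0 : tpol != 0.
Proof.
have -> : tpol = 'X * ('X + 1) by rewrite /tpol; ring.
by rewrite mulf_neq0 ?polyX_eq0 // -size_poly_eq0 size_XaddC.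
Qed.

Lemma dvdp_tpol h : h.[0] = 0 -> h.[1] = 0 -> exists g, h = g * tpol.
Proof.
move=> h0 h1.
have : ('X - 0%:P) * ('X - 1%:P) %| h.
  have := @uniq_roots_dvdp _ h [:: 0; 1].
  rewrite !big_cons big_nil mulr1; apply.
    by rewrite /= /root h0 h1 eqxx.
  by rewrite uniq_rootsE.
case/dvdpP => g ->; exists g; congr (_ * _).
by rewrite subr0 polyC1 (opp_char2 (1 : {poly 'F_2})) /tpol; ring.
Qed.

(** The fixed ring is Z/2[t]: a fixed polynomial takes the same value at 0 and 1, so
its difference with that value is divisible by t, and the quotient is fixed again. *)
Lemma atkin_fixed h : atkin h = h -> exists g, h = g \Po tpol.
Proof.
have [n] := ubnP (size h); elim: n h => // n IH h hn hw.
have [h1|h1] := leqP (size h) 1.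
  by exists h; rewrite [h]size1_polyC // comp_polyC.
have e01 : h.[1] = h.[0] by rewrite -{2}hw horner_atkin add0r.
have [||g eg] := @dvdp_tpol (h - h.[0]%:P).
- by rewrite hornerD hornerN hornerC subrr.
- by rewrite hornerD hornerN hornerC e01 subrr.
have gw : atkin g = g.
  apply: (mulIf tpol_neq0); rewrite -{1}atkin_tpol -atkinM -eg.
  by rewrite /atkin comp_polyB comp_polyC -/(atkin h) hw.
have eh : h = g * tpol + h.[0]%:P by rewrite -eg subrK.
have [|//|k ek] := IH g.
  have [->|g0] := eqVneq g 0; first by rewrite size_poly0; lia.
  have st : size tpol = 3%N by rewrite /tpol size_polyDl size_polyXn ?size_polyX.
  have sg : size (g * tpol) = (size g + 2)%N.
    by rewrite (size_mul g0 tpol_neq0) st addnS.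
  have : (size g + 2 <= maxn (size h) 1)%N.
    rewrite -sg -eg (leq_trans (size_polyD _ _)) // geq_max leq_maxl size_polyN.
    by rewrite (leq_trans (size_polyC_leq1 _)) // leq_maxr.
  rewrite (maxn_idPl (ltnW h1)) => gh; move: (leq_trans gh hn).
  by rewrite addn2 => /ltnW.
exists (k * 'X + h.[0]%:P).
by rewrite comp_polyD comp_polyM comp_polyX comp_polyC -ek.
Qed.

(* The odd polynomials in t. *)
Local Notation T := (lincomb (fun m => tpol ^+ (2 * m + 1))).

(** The coefficients are their own squares. *)
Lemma T_sqr h : T h = tpol * (h \Po tpol) ^+ 2.
Proof.
have -> : (h \Po tpol) ^+ 2 = h \Po tpol ^+ 2.
  by rewrite -(comp_Xn_poly tpol 2) comp_polyA poly_sqr [RHS]rmorphXn.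
rewrite comp_polyE mulr_sumr; apply: eq_bigr => k _.
by rewrite -scalerAr -exprM -exprS addn1.
Qed.

Lemma atkin_T h : atkin (T h) = T h.
Proof.
rewrite T_sqr atkinM atkinXn atkin_tpol; congr (_ * _ ^+ 2).
by rewrite /atkin -comp_polyA -/(atkin tpol) atkin_tpol.
Qed.

Lemma defect_T h : defect (T h) = U5 (ev (T h)) + ev (T h).
Proof. by rewrite /defect atkin_T. Qed.

Lemma supp_tsqr f : supported 2 1 ((r ^+ 2 + r) * f ^+ 2).
Proof.
apply: (@supportedM _ 2 1 0).
  by move=> n n1; apply: r_sqr_r_even; apply: contra n1; rewrite modn2 => ->.
by rewrite expr2 fps_sqr; apply: supported_dilate.
Qed.

Lemma odd_supp (f : Z2x) : (forall n, ~~ odd n -> f n = 0) <-> supported 2 1 f.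
Proof.
split=> f0 n n1; apply: f0; last by rewrite modn2 (negPf n1).
by apply: contra n1; rewrite modn2 => ->.
Qed.

(** Splitting a polynomial into even and odd exponents and substituting X = t + X^2
writes it as a^2 + t b^2. A square is an even series and t b^2 an odd one, so a
vanishes when the series is odd. *)
Lemma Modd_tsqr f : Modd f -> exists h, f = ev (tpol * h ^+ 2).
Proof.
move=> [[h _ <-]] /odd_supp fo.
pose a := even_poly h; pose b := odd_poly h.
have eh : h = (a + b * 'X) ^+ 2 + tpol * b ^+ 2.
  rewrite -[h in LHS]poly_even_odd !poly_sqr -/a -/b sqrD2.
  by apply: (@eq_char2 _ _ _ (- b ^+ 2 * 'X^2)); rewrite /tpol; ring.
have eb : ev (tpol * b ^+ 2) = (r ^+ 2 + r) * ev b ^+ 2 by rewrite evM evX ev_tpol.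
have ef : ev h = ev (a + b * 'X) ^+ 2 + ev (tpol * b ^+ 2) by rewrite -evX -evD -eh.
exists b; rewrite ef.
suff -> : ev (a + b * 'X) ^+ 2 = 0 by rewrite add0r.
have es : ev (a + b * 'X) ^+ 2 = ev h + ev (tpol * b ^+ 2).
  by rewrite ef -addrA add_char2 addr0.
have se : supported 2 0 (ev (a + b * 'X) ^+ 2) by rewrite expr2 fps_sqr; apply: supported_dilate.
have so : supported 2 1 (ev (a + b * 'X) ^+ 2).
  by rewrite es; apply: (supportedD fo); rewrite eb; apply: supp_tsqr.
apply: fpsP => n; case: (boolP (odd n)) => on; first by rewrite se // modn2 on.
by rewrite so // modn2 (negPf on).
Qed.

(** F has order 1 and G order 5, so F^k + G^k has order k for k > 0. *)
Lemma hornerFG (c : {poly 'F_2}) : horner_alg F c = horner_alg G c -> c = (c`_0)%:P.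
Proof.
move=> e; apply/eqP; rewrite -subr_eq0; apply/eqP.
apply: (@has_ord_indep id (fun k => F ^+ k + G ^+ k)) => //.
  move=> k; rewrite coefB coefC.
  case: k => [|k _]; first by rewrite subrr eqxx.
  have [F0 F1] := has_ordX k.+1 has_ord_F; rewrite muln1 in F0 F1.
  have [G0 _] := has_ordX k.+1 has_ord_G.
  have Gz n : (n <= k.+1)%N -> (G ^+ k.+1) n = 0 by move=> nk; apply: G0; lia.
  move: (F ^+ k.+1) (G ^+ k.+1) F0 F1 Gz {G0} => f g F0 F1 Gz.
  split=> [n nk|]; rewrite fps_coefD.
    by rewrite (F0 _ nk) (Gz _ (ltnW nk)) addr0.
  by rewrite F1 (Gz _ (leqnn _)) addr0.
have ->: (c`_0)%:P = c`_0 *: 'X^0 by rewrite -mul_polyC expr0 mulr1.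
rewrite linearB /= lincombZXn /= !expr0 (_ : 1 + 1 = 0 :> Z2x) ?scaler0 ?subr0; last exact: add_char2.
transitivity (horner_alg F c + horner_alg G c); last by rewrite e; exact: add_char2.
rewrite !horner_alg_lincomb -big_split /=; apply: eq_bigr => k _.
by rewrite scalerDr.
Qed.

Lemma atkin_comp_Fpol c : atkin (c \Po Fpol) = c \Po Gpol.
Proof. by rewrite /atkin -comp_polyA -/(atkin Fpol) atkin_Fpol. Qed.

(** If f = h(r) is fixed by U5, then h + w h lies in Z/2[F], and in Z/2[G] by applying
w; so it is a constant, which is 0 since t divides h. Hence f is invariant under w. Writing
f = t a^2, the polynomial a is invariant too, so f is an odd polynomial in t.
Conversely U5 and w differ by the defect, and w fixes T p. *)
Lemma K_iff_T f : K f <-> exists p, f = ev (T p) /\ defect (T p) = 0.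
Proof.
split=> [[fo fU]|[p [-> dp]]]; last first.
  split; last by rewrite -defect_T.
  split; first by exists (T p).
  apply/odd_supp; rewrite T_sqr evM evX ev_tpol; exact: supp_tsqr.
have [h ef] := Modd_tsqr fo.
suff hw : atkin h = h.
  have [p ep] := atkin_fixed hw; exists p.
  by rewrite defect_T T_sqr -ep -ef; split.
set g := tpol * h ^+ 2 in ef.
have [c ec] := defect_hornerF g.
have Uf : U5 f = f by rewrite -[RHS]add0r -fU -addrA add_char2 addr0.
have e1 : g + atkin g = c \Po Fpol.
  by apply: ev_inj; rewrite comp_alg ev_Fpol -ec /defect -ef Uf evD -ef.
have e2 : g + atkin g = c \Po Gpol.
  by rewrite -atkin_comp_Fpol -e1 atkinD atkinK addrC.
have ecc : c = (c`_0)%:P.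
  have eF : ev (c \Po Fpol) = horner_alg F c by rewrite comp_alg ev_Fpol.
  have eG : ev (c \Po Gpol) = horner_alg G c by rewrite comp_alg ev_Gpol.
  exact: hornerFG (etrans (esym eF) (etrans (congr1 _ (etrans (esym e1) e2)) eG)).
have tp0 : tpol.[0] = 0 by rewrite /tpol hornerD hornerXn hornerX expr0n addr0.
have tp1 : tpol.[1] = 0 by rewrite /tpol hornerD hornerXn hornerX expr1n; apply/val_inj.
have c0 : c`_0 = 0.
  have := congr1 (fun q : {poly 'F_2} => q.[0]) e1.
  rewrite ecc comp_polyC hornerC hornerD horner_atkin add0r /g !hornerM tp0 tp1.
  by rewrite !mul0r addr0 coefC eqxx.
have gw : atkin g = g.
  by apply/esym/char2_eq; rewrite e1 ecc c0 comp_polyC.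
have : tpol * (atkin h) ^+ 2 = tpol * h ^+ 2.
  by rewrite -{1}atkin_tpol -atkinXn -atkinM.
move/(mulfI tpol_neq0) => e3.
have : (atkin h + h) ^+ 2 = 0 by rewrite sqrD2 e3 add_char2.
by move/eqP; rewrite sqrf_eq0 => /eqP; apply: char2_eq.
Qed.

(** * The kernel modulo the complementary monomials *)

(** Sum of the triangular relations over the coefficients of p; the top coefficient
is preserved. *)
Lemma T_lincomb_Epol p : exists q, spanW btype (T p - lincomb Epol q) /\
  (size (q - p)%R <= (size p).-1)%N.
Proof.
have /choice[l lP] m : exists q : {poly 'F_2}, (size q <= m)%N /\
    spanW btype (tpol ^+ (2 * m + 1) - lincomb Epol ('X^m + q)).
  by have [q] := t_pow_triangular m; exists q.
exists (\sum_(k < size p) p`_k *: ('X^k + l k)); split.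
  have -> : lincomb Epol (\sum_(k < size p) p`_k *: ('X^k + l k)) =
      \sum_(k < size p) lincomb Epol (p`_k *: ('X^k + l k)) by exact: linear_sum.
  rewrite [T p]/lincomb -sumrB; apply: spanW_sum => k _.
  by rewrite linearZ /= -scalerBr; apply: spanWZ; have [] := lP k.
rewrite -[X in _ - X]coefK poly_def -sumrB.
apply: (leq_trans (size_sum _ _ _)); apply/bigmax_leqP => k _.
rewrite -scalerBr addrC addKr (leq_trans (size_scale_leq _ _)) //.
have [lk _] := lP k; apply: (leq_trans lk); have := ltn_ord k; lia.
Qed.

(** Triangular elimination from the top. *)
Lemma lincomb_Epol_T q : exists p, spanW btype (lincomb Epol q - T p).
Proof.
have [n] := ubnP (size q); elim: n q => // n IH q qn.
have [q0|q0] := eqVneq q 0.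
  by exists 0; rewrite q0 /lincomb size_poly0 !big_ord0 subrr; apply: spanW0.
have sq : (0 < size q)%N by rewrite size_poly_gt0.
pose m := (size q).-1; have em : size q = m.+1 := esym (prednK sq).
have [l lm lT] := t_pow_triangular m.
have [|p pT] := IH (q - q`_m *: ('X^m + l)).
  rewrite -ltnS in qn; rewrite em in qn; apply: leq_trans (_ : m.+1 <= _)%N => //.
  rewrite ltnS; apply/leq_sizeP => j mj.
  rewrite coefB coefZ coefD coefXn (nth_default 0 (leq_trans lm mj)) addr0.
  have [->|jm] := eqVneq j m; first by rewrite mulr1 subrr.
  by rewrite mulr0 subr0 nth_default // em ltn_neqAle eq_sym jm.
exists (p + q`_m *: 'X^m).
have -> : lincomb Epol q - T (p + q`_m *: 'X^m) = (lincomb Epol (q - q`_m *: ('X^m + l)) - T p)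
    + - q`_m *: (tpol ^+ (2 * m + 1) - lincomb Epol ('X^m + l)).
  have -> : lincomb Epol (q - q`_m *: ('X^m + l)) = lincomb Epol q - q`_m *: lincomb Epol ('X^m + l).
    by rewrite linearB linearZ.
  have -> : T (p + q`_m *: 'X^m) = T p + q`_m *: tpol ^+ (2 * m + 1).
    by rewrite linearD /= lincombZXn.
  by rewrite scaleNr scalerBr; ring.
by apply: spanWD => //; apply: spanWZ.
Qed.

(** No monomial of the combination of the Epol m involves t^5. *)
Definition no_t5 (q : {poly 'F_2}) := forall m, q`_m != 0 -> Epol_texp m != 5%N.

Lemma Epol_texp_lt6 m : (Epol_texp m < 6)%N.
Proof.
by rewrite /Epol_texp; have := ltn_pmod m (isT : (0 < 6)%N); case: (m %% 6)%N => [|[|[|[|[|[|]]]]]].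
Qed.

Lemma defect_Epol m : defect (Epol m) = if Epol_texp m == 5%N then F ^+ (Epol_Gexp m).+1 else 0.
Proof. by rewrite defect_monomial ?Epol_texp_lt6. Qed.

Lemma defect_spanW S h : spanW S h -> defect h = 0.
Proof.
move=> [c _ ->]; rewrite linear_lincomb /lincomb big1 // => k _.
have k5 : (k %% 5 < 5)%N by rewrite ltn_pmod.
by rewrite /Wpol /= defect_monomial ?(ltn_trans k5) // ltn_eqF ?scaler0.
Qed.

Lemma divn_modn_inj d j k : (j %/ d = k %/ d)%N -> (j %% d = k %% d)%N -> j = k.
Proof. by move=> e f; rewrite (divn_eq j d) (divn_eq k d) e f. Qed.

Lemma Epol_Gexp_inj j k :
  Epol_texp j = 5%N -> Epol_texp k = 5%N -> Epol_Gexp j = Epol_Gexp k -> j = k.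
Proof.
move=> j5 k5 e; suff [] : (j %/ 6 = k %/ 6)%N /\ (j %% 6 = k %% 6)%N.
  exact: divn_modn_inj.
move: j5 k5 e; rewrite /Epol_texp /Epol_Gexp.
have := ltn_pmod j (isT : (0 < 6)%N); have := ltn_pmod k (isT : (0 < 6)%N).
move: (j %/ 6)%N (k %/ 6)%N (j %% 6)%N (k %% 6)%N => a b x y.
by case: x => [|[|[|[|[|[|]]]]]]; case: y => [|[|[|[|[|[|]]]]]] //=; lia.
Qed.

(** Only t^5 has a defect, and the defects of the different G^b t^5 are different
powers of F. *)
Lemma defect_lincomb_Epol q : defect (lincomb Epol q) = 0 <-> no_t5 q.
Proof.
rewrite linear_lincomb; split=> [d0|q5]; last first.
  rewrite /lincomb big1 // => k _; rewrite /= defect_Epol.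
  by have [->|/q5/negPf->] := eqVneq q`_k 0; rewrite ?scale0r ?scaler0.
pose c := \poly_(m < size q) (if Epol_texp m == 5%N then q`_m else 0).
have cE m : c`_m = if Epol_texp m == 5%N then q`_m else 0.
  rewrite coef_poly; case: ltnP => // qm; rewrite nth_default //.
  by case: ifP.
have c0 : c = 0.
  apply: (@has_ord_indep (fun m => (Epol_Gexp m).+1) (fun m => F ^+ (Epol_Gexp m).+1)).
  - by move=> k _; rewrite -{1}(muln1 (Epol_Gexp k).+1); apply: has_ordX has_ord_F.
  - move=> j k; rewrite !cE; case: (Epol_texp j =P 5%N) => [j5 _|_]; last by rewrite eqxx.
    case: (Epol_texp k =P 5%N) => [k5 _|_]; last by rewrite eqxx.
    by case=> ?; apply: Epol_Gexp_inj.
  rewrite (lincomb_widen _ (size_poly _ _)) -[RHS]d0; apply: eq_bigr => k _.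
  by rewrite cE /= defect_Epol; case: ifP; rewrite ?scale0r ?scaler0.
move=> m qm; apply/negP => m5.
by have := cE m; rewrite c0 coef0 m5 => e; rewrite -e eqxx in qm.
Qed.

(** The number k with Epol m = Wpol k, when t^5 does not occur. *)
Definition Epol_index m := (5 * Epol_Gexp m + Epol_texp m)%N.

Lemma Epol_Wpol m : Epol_texp m != 5%N -> Epol m = Wpol (Epol_index m) /\ atype (Epol_index m).
Proof.
move=> a5; have a6 : (Epol_texp m < 5)%N by rewrite ltn_neqAle a5 -ltnS Epol_texp_lt6.
split.
  by rewrite /Wpol /Epol_index mulnC divnMDl // divn_small // addn0 modnMDl modn_small.
move: a5; rewrite /Epol_index /Epol_Gexp /Epol_texp /atype.
have := ltn_pmod m (isT : (0 < 6)%N).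
have -> x : ((5 * (4 * (m %/ 6) + x)) = m %/ 6 * 20 + 5 * x)%N by lia.
by case: (m %% 6)%N => [|[|[|[|[|[|]]]]]] //= _ _; rewrite -addnA modnMDl.
Qed.

Lemma spanW_lincomb_Epol q : no_t5 q -> spanW atype (lincomb Epol q).
Proof.
move=> q5; apply: spanW_sum => k _.
have [->|/q5/Epol_Wpol[-> aW]] := eqVneq q`_k 0; first by rewrite scale0r; apply: spanW0.
by apply/spanWZ/spanW_Wpol.
Qed.

Lemma has_ord_tpol : has_ord 1 (ev tpol).
Proof.
rewrite ev_tpol (_ : _ + _ = r * (r + 1)); last by ring.
exact: has_ordM has_ord_r has_ord_r1.
Qed.

Lemma has_ord_Wpol k : has_ord k (ev (Wpol k)).
Proof.
rewrite /Wpol evM !evX ev_Gpol {1}(divn_eq k 5).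
apply: has_ordM; first exact: has_ordX has_ord_G.
by have := has_ordX (k %% 5) has_ord_tpol; rewrite muln1.
Qed.

Lemma lincomb_Wpol_eq0 c : lincomb Wpol c = 0 -> c = 0.
Proof.
move=> e; apply: (@has_ord_indep id (fun k => ev (Wpol k))) => //.
  by move=> k _; apply: has_ord_Wpol.
transitivity (ev (lincomb Wpol c)); last by rewrite e rmorph0.
rewrite /lincomb; elim/big_rec2: _ => [|k x y _ ->]; first by rewrite rmorph0.
by rewrite evD horner_algZ.
Qed.

Lemma ev_lincomb v c : ev (lincomb v c) = lincomb (fun k => ev (v k)) c.
Proof.
rewrite /lincomb; elim/big_rec2: _ => [|k x y _ <-]; first by rewrite rmorph0.
by rewrite evD horner_algZ.
Qed.

Lemma Epol_index_inj j k :
  Epol_texp j != 5%N -> Epol_texp k != 5%N -> Epol_index j = Epol_index k -> j = k.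
Proof.
move=> j5 k5 e; suff [] : (j %/ 6 = k %/ 6)%N /\ (j %% 6 = k %% 6)%N.
  exact: divn_modn_inj.
move: j5 k5 e; rewrite /Epol_index /Epol_texp /Epol_Gexp.
have := ltn_pmod j (isT : (0 < 6)%N); have := ltn_pmod k (isT : (0 < 6)%N).
move: (j %/ 6)%N (k %/ 6)%N (j %% 6)%N (k %% 6)%N => a b x y.
by case: x => [|[|[|[|[|[|]]]]]]; case: y => [|[|[|[|[|[|]]]]]] //=; lia.
Qed.

Lemma lincomb_Epol_eq0 q : no_t5 q -> lincomb Epol q = 0 -> q = 0.
Proof.
move=> q5 e; apply: (@has_ord_indep Epol_index (fun m => ev (Epol m))).
- by move=> k /q5/Epol_Wpol[-> _]; apply: has_ord_Wpol.
- by move=> j k /q5 j5 /q5 k5; apply: Epol_index_inj.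
by rewrite -ev_lincomb e rmorph0.
Qed.

(** The Wpol k are independent because of their orders. *)
Lemma spanW_disjoint g : spanW atype g -> spanW btype g -> g = 0.
Proof.
move=> [c ca ->] [d db e].
have cd : c = d.
  apply/eqP; rewrite -subr_eq0; apply/eqP/lincomb_Wpol_eq0.
  by rewrite linearB /= e subrr.
suff -> : c = 0 by rewrite linear0.
apply/polyP => k; rewrite coef0; apply: contra_eq (erefl k) => ck.
have := ca k ck; rewrite cd in ck; have := db k ck.
rewrite /atype /btype !inE.
by case/or4P => [||| /or3P[||]] /eqP ->.
Qed.

(** The element of the kernel has no defect, nor has the part of type b; so t^5 is
absent from the leading part. *)
Lemma K_decomp f : K f -> exists p q b : {poly 'F_2},
  [/\ f = ev (T p), T p = lincomb Epol q + b, spanW btype b, no_t5 q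
    & (size (q - p)%R <= (size p).-1)%N].
Proof.
move=> /K_iff_T[p [-> dp]]; have [q [bW sq]] := T_lincomb_Epol p.
exists p, q, (T p - lincomb Epol q); split => //; first by rewrite addrC subrK.
apply/defect_lincomb_Epol; have := defect_spanW bW.
by rewrite linearB /= dp sub0r => /eqP; rewrite oppr_eq0 => /eqP.
Qed.

(** * Monomials in G and t inside N2 and modulo N1 *)

Lemma G2span_gen B i j : (i < size B)%N -> G ^+ (2 * j) * B`_i \in G2span B.
Proof.
move=> iB; apply/asboolP; exists (fun k => if k == i then 'X^j else 0).
rewrite (bigD1 (Ordinal iB)) //= eqxx rmorphXn /= horner_algX -exprM big1 ?addr0 // => k ki.
have /negPf -> : (k != i :> nat) by apply: contra ki => /eqP e; apply/eqP/val_inj.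
by rewrite rmorph0 mul0r.
Qed.

Lemma N1_Godd k : odd k -> G ^+ k \in N1.
Proof.
move=> ok; have := @G2span_gen [:: G] 0 k./2 isT.
have {2}-> : k = (2 * k./2).+1 by rewrite mul2n -[LHS]odd_double_half ok.
by rewrite exprSr.
Qed.

Lemma N1_Wpol k : (k %% 10 = 5)%N -> ev (Wpol k) \in N1.
Proof.
move=> k5; rewrite /Wpol evM !evX ev_Gpol (_ : k %% 5 = 0)%N; last by lia.
by rewrite expr0 mulr1; apply: N1_Godd; lia.
Qed.

Lemma N1_spanW_btype f : f \in N1 -> exists2 h, spanW btype h & f = ev h.
Proof.
move=> /asboolP[c ->]; rewrite big_ord1 /= horner_alg_lincomb.
exists (\sum_(k < size (c 0%N)) (c 0%N)`_k *: Wpol (10 * k + 5)).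
  by apply: spanW_sum => k _; apply/spanWZ/spanW_Wpol; rewrite /btype !inE; lia.
rewrite mulr_suml; elim/big_rec2: _ => [|k x y _ ->]; first by rewrite rmorph0.
rewrite evD horner_algZ -scalerAl -exprM; congr (_ *: _ + _).
rewrite /Wpol evM !evX ev_Gpol (_ : (10 * k + 5) %/ 5 = (2 * k).+1)%N; last by lia.
by rewrite (_ : (10 * k + 5) %% 5 = 0)%N ?expr0 ?mulr1 ?exprSr //; lia.
Qed.

Lemma ev_tpol_FG : ev tpol = F + G.
Proof.
by rewrite ev_tpol /F /G; apply: (@eq_char2 _ _ _ (- 3 * r ^+ 5 - r ^+ 6 - 5 * r ^+ 4
  - 5 * r ^+ 3 - 2 * r ^+ 2)); ring.
Qed.

(** Expanding the left side of the hypothesis gives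
f^6 = f g + f^2 g^4 + f^4 g^2 + g^6; multiply by f^2 and substitute once more. *)
Lemma pow8_of_pow6 (R : comAlgType 'F_2) (f g : R) :
  (f + g) ^+ 6 = g * (f + g) + g ^+ 2 -> f ^+ 8 = (f ^+ 3 + f * g ^+ 2 + g ^+ 7) * g.
Proof.
move=> e; have f6 : f ^+ 6 = f * g + f ^+ 2 * g ^+ 4 + f ^+ 4 * g ^+ 2 + g ^+ 6.
  have e1 : (f + g) ^+ 6 = f * g by rewrite e; apply: (@eq_char2 _ _ _ (g ^+ 2)); ring.
  apply: char2_eq; transitivity (f * g + (f + g) ^+ 6); last by rewrite e1 add_char2.
  by rewrite (exprD (f + g) 2 4) pow4D2 sqrD2; ring.
rewrite (exprD f 2 6) f6 [LHS](_ : _ = f ^+ 3 * g + f ^+ 4 * g ^+ 4 + f ^+ 6 * g ^+ 2 +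
  f ^+ 2 * g ^+ 6); last by ring.
rewrite f6; apply: (@eq_char2 _ _ _ (f ^+ 4 * g ^+ 4 + f ^+ 2 * g ^+ 6)); ring.
Qed.

(** The quotient F^8 / G, exhibiting J 3 in N2. *)
Lemma J3_formula : J 3 = F ^+ 3 + F * G ^+ 2 + G ^+ 7.
Proof.
apply/eqP; rewrite -subr_eq0; apply/eqP/fps_mulIG; rewrite mulrBl J3_mulG.
have := congr1 ev tpol_pow6; rewrite evD evX evM evX ev_Gpol ev_tpol_FG => e.
by rewrite (pow8_of_pow6 e) subrr.
Qed.

Lemma J_formula k : J k = G ^+ (2 * (k %/ 10)) *
  match (k %% 10)%N with
  | 1 => F | 3 => F ^+ 3 + F * G ^+ 2 + G ^+ 7 | 7 => F ^+ 2 * G | 9 => F ^+ 4 * G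
  | _ => 0
  end.
Proof.
rewrite -J3_formula /J; congr (_ * _).
by have := ltn_pmod k (isT : (0 < 10)%N); case: (k %% 10)%N => [|[|[|[|]]]] //=; rewrite mul1r.
Qed.

Lemma piN1_eq0 f : f \in N1 -> piN1 f = 0.
Proof. by move=> fN; apply/eqP; rewrite -(raddf0 piN1) eq_piN1 subr0. Qed.

Lemma piN1D f g : piN1 (f + g) = piN1 f + piN1 g. Proof. exact: raddfD. Qed.

Lemma piN1_addN1 f g h : h \in N1 -> f = g + h -> piN1 f = piN1 g.
Proof. by move=> hN ->; rewrite piN1D (piN1_eq0 hN) addr0. Qed.

Lemma ev_Wpol k : ev (Wpol k) = G ^+ (k %/ 5) * (F + G) ^+ (k %% 5).
Proof. by rewrite /Wpol evM !evX ev_Gpol ev_tpol_FG. Qed.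

(** Expand t = F + G; squares and fourth powers are additive, and the extra term is
an odd power of G. *)
Lemma piN1_Wpol k : (k %% 10 \in [:: 1; 7; 9])%N -> piN1 (ev (Wpol k)) = piN1 (J k).
Proof.
move=> k10; have ek := divn_eq k 10; rewrite J_formula ev_Wpol.
move: (k %/ 10)%N (k %% 10)%N ek k10 => j i -> {k}; rewrite !inE.
case/or3P => /eqP ->; apply: piN1_addN1.
- apply: (@N1_Godd (2 * j).+1); lia.
- rewrite (_ : (j * 10 + 1) %/ 5 = 2 * j)%N; last by lia.
  rewrite (_ : (j * 10 + 1) %% 5 = 1)%N; last by lia.
  by rewrite (exprS G) expr1; ring.
- apply: (@N1_Godd (2 * j + 3)); lia.
- rewrite (_ : (j * 10 + 7) %/ 5 = 2 * j + 1)%N; last by lia.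
  rewrite (_ : (j * 10 + 7) %% 5 = 2)%N; last by lia.
  by rewrite sqrD2 !(exprD G (2 * j)); ring.
- apply: (@N1_Godd (2 * j + 5)); lia.
rewrite (_ : (j * 10 + 9) %/ 5 = 2 * j + 1)%N; last by lia.
rewrite (_ : (j * 10 + 9) %% 5 = 4)%N; last by lia.
by rewrite pow4D2 !(exprD G (2 * j)); ring.
Qed.

(** Here t^3 = F^3 + F^2 G + F G^2 + G^3 contributes J (k + 4) through F^2 G. *)
Lemma piN1_Wpol3 k : (k %% 10 = 3)%N ->
  piN1 (ev (Wpol k)) = piN1 (J k) + piN1 (J (k + 4)).
Proof.
move=> k3; rewrite -piN1D; have ek := divn_eq k 10; rewrite !J_formula ev_Wpol k3.
rewrite (_ : (k + 4) %/ 10 = k %/ 10)%N; last by lia.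
rewrite (_ : (k + 4) %% 10 = 7)%N; last by lia.
rewrite (_ : k %/ 5 = 2 * (k %/ 10))%N; last by lia.
rewrite (_ : k %% 5 = 3)%N; last by lia.
move: (k %/ 10)%N => j; apply: (@piN1_addN1 _ _ (G ^+ (2 * j + 7) + G ^+ (2 * j + 3))).
  by apply: rpredD; apply: N1_Godd; lia.
rewrite !(exprD G (2 * j)); apply: (@eq_char2 _ _ _ (G ^+ (2 * j) * (F ^+ 2 * G + F * G ^+ 2 - G ^+ 7))).
ring.
Qed.

Lemma N2_Wpol k : odd k -> ev (Wpol k) \in N2.
Proof.
have gen i j := @G2span_gen [:: G; F; F ^+ 2 * G; F ^+ 3; F ^+ 4 * G] i j.
have gG j : G ^+ (2 * j) * G \in N2 by apply: (gen 0%N).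
have gF j : G ^+ (2 * j) * F \in N2 by apply: (gen 1%N).
have gF2 j : G ^+ (2 * j) * (F ^+ 2 * G) \in N2 by apply: (gen 2%N).
have gF3 j : G ^+ (2 * j) * F ^+ 3 \in N2 by apply: (gen 3%N).
have gF4 j : G ^+ (2 * j) * (F ^+ 4 * G) \in N2 by apply: (gen 4%N).
have G2j j : G ^+ (2 * j.+1) = G ^+ (2 * j) * G ^+ 2 by rewrite -exprD; congr (_ ^+ _); lia.
move=> ok; have [k5 [j ej]] : (k %% 5 < 5)%N /\ exists j, (k %/ 5 = 2 * j + ~~ odd (k %% 5))%N.
  split; first by rewrite ltn_pmod.
  exists (k %/ 5)./2; have := divn_eq k 5; lia.
rewrite ev_Wpol ej {ej}; move: (k %% 5)%N k5 => [|[|[|[|[|//]]]]] _ /=; rewrite ?addn0 ?(exprD _ _ 1).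
- by rewrite mulr1; apply: gG.
- by rewrite expr1 mulrDr rpredD.
- rewrite sqrD2 (_ : _ * _ = G ^+ (2 * j) * (F ^+ 2 * G) + G ^+ (2 * j.+1) * G); last first.
    by rewrite G2j; ring.
  by rewrite rpredD.
- rewrite (_ : _ * _ = G ^+ (2 * j) * F ^+ 3 + G ^+ (2 * j) * (F ^+ 2 * G) + G ^+ (2 * j.+1) * F
    + G ^+ (2 * j.+1) * G); last first.
    rewrite G2j; apply: (@eq_char2 _ _ _ (G ^+ (2 * j) * (F ^+ 2 * G + F * G ^+ 2))); ring.
  by rewrite !rpredD.
rewrite pow4D2 (_ : _ * _ = G ^+ (2 * j) * (F ^+ 4 * G) + G ^+ (2 * j.+2) * G); last first.
  by rewrite !G2j; ring.
by rewrite rpredD.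
Qed.

Lemma N2_spanW (S : pred nat) h : (forall k, S k -> odd k) -> spanW S h -> ev h \in N2.
Proof.
move=> So [c cS ->]; rewrite ev_lincomb; apply: rpred_sum => k _.
have [->|/cS/So ok] := eqVneq c`_k 0; first by rewrite scale0r rpred0.
by rewrite rpredZ // N2_Wpol.
Qed.

(** * The two halves of N2 / N1 *)

Section LinSpan.
Variables (R : pzRingType) (V : lmodType R) (S : set V).

Lemma lin_span_gen v : S v -> lin_span S v.
Proof. by move=> Sv; exists 1%N, (fun=> 1), (fun=> v); rewrite big_ord1 scale1r. Qed.

Lemma lin_span0 : lin_span S 0.
Proof. by exists 0%N, (fun=> 0), (fun=> 0); split=> [[]|] //; rewrite big_ord0. Qed.

Lemma lin_spanZ a v : lin_span S v -> lin_span S (a *: v).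
Proof.
move=> [n [c [w [wS ->]]]]; exists n, (fun i => a * c i), w; split=> //.
by rewrite scaler_sumr; apply: eq_bigr => i _; rewrite scalerA.
Qed.

Lemma lin_spanD u v : lin_span S u -> lin_span S v -> lin_span S (u + v).
Proof.
move=> [n [c [w [wS ->]]]] [m [d [x [xS ->]]]].
exists (n + m)%N, (fun i => match fintype.split i with inl j => c j | inr j => d j end),
  (fun i => match fintype.split i with inl j => w j | inr j => x j end); split.
  by move=> i; case: (fintype.split i).
rewrite big_split_ord; congr (_ + _); apply: eq_bigr => i _.
  by rewrite (unsplitK (inl i)).
by rewrite (unsplitK (inr i)).
Qed.

Lemma lin_span_min (P : V -> Prop) : P 0 -> (forall u v, P u -> P v -> P (u + v)) ->
  (forall a v, P v -> P (a *: v)) -> (forall v, S v -> P v) ->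
  forall v, lin_span S v -> P v.
Proof.
move=> P0 PD PZ PS v [n [c [w [wS ->]]]]; elim/big_ind: _ => // i _.
exact/PZ/PS.
Qed.

End LinSpan.

Lemma piN1_scale a f : piN1 (a *: f) = a *: piN1 f.
Proof. by rewrite -piN1Z. Qed.

Lemma piN1_evD g h : piN1 (ev (g + h)) = piN1 (ev g) + piN1 (ev h).
Proof. exact: etrans (congr1 piN1 (evD g h)) (piN1D _ _). Qed.

(* Both halves of N2 / N1 are spanned by the J k with k in a set S that contains
   k + 4 along with k = 3 modulo 10; then the J k and the Wpol k, k in S, have the
   same span modulo N1. *)
Section JSpan.
Variable S : pred nat.
Hypothesis S10 : forall k, S k -> (k %% 10 \in [:: 1; 3; 7; 9])%N.
Hypothesis S3 : forall k, S k -> (k %% 10 = 3)%N -> S (k + 4)%N.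

Definition Jspan := lin_span [set piN1 (J k) | k in [set k | S k]]%classic.

Lemma piN1_J k : S k -> exists2 h, spanW S h & piN1 (J k) = piN1 (ev h).
Proof.
move=> Sk; have := S10 Sk; rewrite !inE => k10.
have [k3|k3] := eqVneq (k %% 10)%N 3%N; last first.
  by exists (Wpol k); [apply: spanW_Wpol|rewrite piN1_Wpol // !inE; lia].
exists (Wpol k + Wpol (k + 4)%N); first by apply: spanWD; apply: spanW_Wpol => //; apply: S3.
have e4 : piN1 (ev (Wpol (k + 4))) = piN1 (J (k + 4)).
  by apply: piN1_Wpol; rewrite !inE; lia.
apply/esym/(etrans (piN1_evD _ _))/(etrans (congr2 +%R (piN1_Wpol3 k3) e4)).
rewrite -addrA; exact: etrans (congr1 _ (add_char2 _)) (addr0 _).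
Qed.

Lemma Jspan_spanW v : Jspan v -> exists2 h, spanW S h & v = piN1 (ev h).
Proof.
apply: (@lin_span_min _ _ _ (fun v => exists2 h, spanW S h & v = piN1 (ev h)))
  => [|_ _ [g gS ->] [h hS ->]|a _ [h hS ->]|_ [k Sk <-]].
- by exists 0; [apply: spanW0|rewrite rmorph0 raddf0].
- by exists (g + h); [apply: spanWD|rewrite evD piN1D].
- by exists (a *: h); [apply: spanWZ|rewrite horner_algZ piN1_scale].
exact: piN1_J.
Qed.

Lemma spanW_Jspan h : spanW (fun k => S k || (k %% 10 == 5)%N) h -> Jspan (piN1 (ev h)).
Proof.
move=> [c cS ->]; rewrite ev_lincomb /lincomb; elim/big_rec: _ => [|k f _ IH].
  by rewrite raddf0; apply: lin_span0.
rewrite piN1D piN1_scale; apply: lin_spanD => //.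
have [->|/cS/orP[Sk|/eqP k5]] := eqVneq c`_k 0.
- by rewrite scale0r; apply: lin_span0.
- apply: lin_spanZ; have := S10 Sk; rewrite !inE => k10.
  have [k3|k3] := eqVneq (k %% 10)%N 3%N; last first.
    by rewrite piN1_Wpol ?inE; [apply: lin_span_gen; exists k|lia].
  rewrite piN1_Wpol3 //; apply: lin_spanD; apply: lin_span_gen.
    by exists k.
  by exists (k + 4)%N => //; apply: S3.
by apply: lin_spanZ; rewrite (piN1_eq0 (N1_Wpol k5)); apply: lin_span0.
Qed.

End JSpan.

(** The part of btype not coming from N1. *)
Definition btypeJ k := (k %% 20 \in [:: 11; 13; 17; 19])%N.

Lemma spanW_sub (S S' : pred nat) h : (forall k, S k -> S' k) -> spanW S h -> spanW S' h.
Proof. by move=> SS [c cS ->]; exists c => // k /cS/SS. Qed.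

Lemma atype_mod10 k : atype k -> (k %% 10 \in [:: 1; 3; 7; 9])%N.
Proof. by rewrite /atype !inE; lia. Qed.
Lemma btypeJ_mod10 k : btypeJ k -> (k %% 10 \in [:: 1; 3; 7; 9])%N.
Proof. by rewrite /btypeJ !inE; lia. Qed.
Lemma atype_add4 k : atype k -> (k %% 10 = 3)%N -> atype (k + 4).
Proof. by rewrite /atype !inE; lia. Qed.
Lemma btypeJ_add4 k : btypeJ k -> (k %% 10 = 3)%N -> btypeJ (k + 4).
Proof. by rewrite /btypeJ !inE; lia. Qed.

Lemma N2aP v : N2a v <-> exists2 h, spanW atype h & v = piN1 (ev h).
Proof.
split; first exact: (Jspan_spanW atype_mod10 atype_add4).
move=> [h ha ->]; apply: (spanW_Jspan atype_mod10 atype_add4).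
by apply: spanW_sub ha => k ->.
Qed.

Lemma N2bP v : N2b v <-> exists2 h, spanW btype h & v = piN1 (ev h).
Proof.
split.
  move=> /(Jspan_spanW btypeJ_mod10 btypeJ_add4)[h hb ->]; exists h => //.
  by apply: spanW_sub hb => k; rewrite /btypeJ /btype !inE; lia.
move=> [h hb ->]; apply: (spanW_Jspan btypeJ_mod10 btypeJ_add4).
by apply: spanW_sub hb => k; rewrite /btypeJ /btype !inE; lia.
Qed.

Lemma K_of_defect_T p : defect (T p) = 0 -> K (ev (T p)).
Proof. by move=> d; apply/K_iff_T; exists p. Qed.

Lemma size_le_pred (p : {poly 'F_2}) : (size p <= (size p).-1)%N -> p = 0.
Proof.
move=> h; apply/eqP; apply: contraLR h => p0.
by rewrite -ltnNge ltn_predL size_poly_gt0.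
Qed.

(** N1 is contained in the span of type b. *)
Lemma N1_spanW g h : spanW atype g -> spanW btype h -> ev (g + h) \in N1 -> g = 0.
Proof.
move=> ga hb /N1_spanW_btype[k kb /ev_inj ek]; apply: (spanW_disjoint ga).
have -> : g = k + h by rewrite -ek -addrA add_char2 addr0.
exact: spanWD.
Qed.

Lemma N1_of_piN1 g g' : piN1 (ev g) = piN1 (ev g') -> ev (g + g') \in N1.
Proof.
move=> e; have := etrans (esym (eq_piN1 _ _)) (introT eqP e).
by rewrite opp_char2 evD.
Qed.

Lemma eq_piN1_atype g g' : spanW atype g -> spanW atype g' ->
  piN1 (ev g) = piN1 (ev g') -> g = g'.
Proof.
move=> ga ga' /N1_of_piN1 e; apply: char2_eq.
by apply: (N1_spanW (spanWD ga ga') (spanW0 _)); rewrite addr0.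
Qed.

Lemma eq_piN1_sum g g' h h' : spanW atype g -> spanW atype g' ->
  spanW btype h -> spanW btype h' ->
  piN1 (ev g) + piN1 (ev h) = piN1 (ev g') + piN1 (ev h') -> g = g'.
Proof.
move=> ga ga' hb hb' e; apply: char2_eq.
apply: (N1_spanW (spanWD ga ga') (spanWD hb hb')); rewrite addrACA.
exact: N1_of_piN1 (etrans (piN1_evD g h) (etrans e (esym (piN1_evD g' h')))).
Qed.

Lemma proj_along_uniq (V : zmodType) (A B : set V) a b : A a -> B b ->
  (forall a' b', A a' -> B b' -> a + b = a' + b' -> a' = a) ->
  proj_along A B (a + b) = a.
Proof.
move=> Aa Bb uniq_a; apply: xget_unique; first by split=> //; rewrite addrC addKr.
by move=> u [Au Bu]; apply: (uniq_a _ _ Au Bu); rewrite [RHS]addrC subrK.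
Qed.

Lemma proj_N2 g h : spanW atype g -> spanW btype h ->
  proj_along N2a N2b (piN1 (ev g) + piN1 (ev h)) = piN1 (ev g).
Proof.
move=> ga hb; apply: proj_along_uniq; first by apply/N2aP; exists g.
  by apply/N2bP; exists h.
move=> _ _ /N2aP[g' ga' ->] /N2bP[h' hb' ->] e.
exact/esym/(congr1 (fun x => piN1 (ev x)))/(eq_piN1_sum ga ga' hb hb').
Qed.

(** Inverse of the numbering Epol_index. *)
Lemma spanW_atype_Epol h : spanW atype h -> exists2 q, no_t5 q & h = lincomb Epol q.
Proof.
move=> [c ca ->]; rewrite [lincomb Wpol c]/lincomb; elim/big_rec: _ => [|k f _ [q q5 ->]].
  by exists 0; rewrite ?linear0 // => m; rewrite coef0 eqxx.
have [->|/ca ak] := eqVneq c`_k 0; first by exists q => //; rewrite scale0r add0r.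
pose c' := nth 0%N [:: 0; 0; 0; 1; 0; 0; 0; 3; 0; 4]%N (k %% 20).
pose m := (6 * (k %/ 20) + c')%N.
have [m5 mk] : Epol_texp m != 5%N /\ Epol_index m = k.
  move: ak; rewrite /atype !inE => ak; have ek := divn_eq k 20.
  have c6 : (c' < 6)%N by case/or4P: ak => /eqP e; rewrite /c' e.
  rewrite /Epol_index /Epol_texp /Epol_Gexp (_ : m %/ 6 = k %/ 20)%N; last by rewrite /m; lia.
  rewrite (_ : m %% 6 = c')%N; last by rewrite /m; lia.
  by rewrite /c'; case/or4P: ak ek => /eqP -> /= ek; split=> //; lia.
have [EWm _] := Epol_Wpol m5; rewrite mk in EWm.
exists (c`_k *: 'X^m + q); last by rewrite linearD linearZ /= lincombXn EWm.
move=> j; rewrite coefD coefZ coefXn; have [->//|jm] := eqVneq j m.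
by rewrite mulr0 add0r; apply: q5.
Qed.

Theorem lemma5p5 :
  (forall f : Z2x, K f -> f \in N2) /\
  set_bij K N2a (fun f : Z2x => proj_along N2a N2b (piN1 f)).
Proof.
have aodd k : atype k -> odd k by rewrite /atype !inE; lia.
have bodd k : btype k -> odd k by rewrite /btype !inE; lia.
split.
  move=> f /K_decomp[p [q [b [-> -> bW q5 _]]]]; rewrite evD rpredD //.
    exact: (N2_spanW aodd (spanW_lincomb_Epol q5)).
  exact: (N2_spanW bodd bW).
have projK (f : Z2x) (p q b : {poly 'F_2}) : f = ev (T p) ->
    T p = lincomb Epol q + b -> spanW btype b -> no_t5 q ->
    proj_along N2a N2b (piN1 f) = piN1 (ev (lincomb Epol q)).
  move=> -> -> bW q5; apply: (etrans (congr1 _ (piN1_evD _ _))).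
  exact: proj_N2 (spanW_lincomb_Epol q5) bW.
split.
- move=> f /K_decomp[p [q [b [ef eT bW q5 _]]]]; rewrite (projK _ _ _ _ ef eT bW q5).
  by apply/N2aP; exists (lincomb Epol q) => //; apply: spanW_lincomb_Epol.
(* The projection determines the leading part, so p + p' is an element of the kernel
   without leading part. *)
- move=> f f'; rewrite !inE => fK fK' e.
  have [p [q [b [ef eT bW q5 _]]]] := K_decomp fK.
  have [p' [q' [b' [ef' eT' bW' q5' _]]]] := K_decomp fK'.
  have {}e := etrans (esym (projK _ _ _ _ ef eT bW q5))
    (etrans e (projK _ _ _ _ ef' eT' bW' q5')).
  have eq : lincomb Epol q = lincomb Epol q'.
    exact: eq_piN1_atype (spanW_lincomb_Epol q5) (spanW_lincomb_Epol q5') e.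
  have dT : T (p + p') = b + b' by rewrite linearD /= eT eT' eq addrACA add_char2 add0r.
  have d0 : defect (T (p + p')) = 0 by rewrite dT (defect_spanW (spanWD bW bW')).
  have [p0 [q0 [b0 [e0 eT0 bW0 q50 sz]]]] := K_decomp (K_of_defect_T d0).
  have q00 : q0 = 0.
    apply: (lincomb_Epol_eq0 q50); apply: (spanW_disjoint (spanW_lincomb_Epol q50)).
    have -> : lincomb Epol q0 = b + b' + b0.
      by rewrite -dT (ev_inj e0) eT0 -addrA add_char2 addr0.
    by do 2?apply: spanWD.
  have p00 : p0 = 0.
    by apply: size_le_pred; rewrite -[p0 in X in (X <= _)%N]opprK size_polyN -sub0r -q00.
  have : ev (T (p + p')) = 0 by rewrite e0 p00 !linear0.
  by rewrite linearD /= evD -ef -ef' => /char2_eq.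
(* Eliminate the leading part h; the result has no defect since h and the part of
   type b have none. *)
- move=> v /N2aP[h hW ->]; have [q q5 eh] := spanW_atype_Epol hW.
  have [p pW] := lincomb_Epol_T q.
  have eT : T p = lincomb Epol q + (-1) *: (lincomb Epol q - T p).
    by rewrite scaleN1r opprB addrC subrK.
  have bW := spanWZ (-1) pW.
  exists (ev (T p)); last by rewrite (projK _ _ _ _ erefl eT bW q5) eh.
  apply: K_of_defect_T; rewrite eT linearD /=.
  by rewrite (defect_spanW bW) addr0; apply/defect_lincomb_Epol.
Qed.
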